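(* Let $(J,r,P)$ be a tree fluid network (defined in the context) satisfying: (T1) if $p_{ij}>0$, then $p_{ij}>r_j/r_i$; (T2) $J_j$ is nondecreasing for $j=2,\ldots,n$; (T3) $J$ is an $n$-dimensional Lévy process; (T4) $J$ is integrable and $(I-P')^{-1}\mathbb E J(1)<r$ (componentwise). Let $X(t)=(I-P')^{-1}J(t)-rt$, $\overline X_k=\sup_{t\ge0}X_k(t)$, $\overline X=(\overline X_1,\ldots,\overline X_n)'$, and let $\mu^*$ be the distribution of $(I-P')\overline X$. Then $\mu^*$ is the only stationary distribution of the buffer-content process $W$.
   Context: Tree fluid network $(J,r,P)$: there are $n$ fluid queues; $J=(J_1,\ldots,J_n)'$ is a càdlàg Lévy process with $J(0)=0$ ($J_j(t)$ is the external input to queue $j$ in $[0,t]$); $r=(r_1,\ldots,r_n)'$ has strictly positive entries (drain rates); the routing matrix $P=(p_{ij})$ is nonnegative with $p_{ii}=0$, $\sum_jp_{ij}\le1$, $p_{ij}=0$ for $j<i$, and every column $j\in\{2,\ldots,n\}$ of $P$ has exactly one strictly positive entry. $P'$ is the transpose of $P$. For an initial condition $w\in\mathbb R_+^n$, the buffer content $W$ and regulator $L$ are the unique càdlàg pair solving the Skorokhod problem of $Y(t)=J(t)-(I-P')rt$: $W(t)=w+Y(t)+(I-P')L(t)$, $W(t)\ge0$, $W(0)=w$, $L(0)=0$, $L$ nondecreasing, and $\sum_j\int_0^\infty W_j(t)\,dL_j(t)=0$. A stationary distribution is a probability distribution $\mu$ on $\mathbb R_+^n$ such that if the initial content $W(0)=w$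 is random, independent of $J$, with distribution $\mu$, then $\{W(t):t\ge0\}$ is a stationary process. *)

(* Defs.v *)
From HB Require Import structures.
From mathcomp Require Import all_boot all_order all_algebra.
From mathcomp Require Import all_classical all_reals all_analysis.
Import Order.TTheory GRing.Theory Num.Theory.
Import numFieldTopology.Exports numFieldNormedType.Exports.

Set Implicit Arguments.
Unset Strict Implicit.
Unset Printing Implicit Defensive.

Local Open Scope classical_set_scope.
Local Open Scope ring_scope.

(* The Borel sigma-algebra of R^n is the one generated by the coordinates;
   the library has the analogous instance for n.-tuple R, but not for 'cV[R]_n. *)
Section measurable_cV.
Context {R : realType} {n : nat}.

Let coord (i : 'I_n) (x : 'cV[R]_n) : R := x i ord0.

Let cV_set0 : g_sigma_preimage coord set0.
Proof. exact: sigma_algebra0. Qed.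

Let cV_setC A : g_sigma_preimage coord A -> g_sigma_preimage coord (~` A).
Proof. exact: sigma_algebraC. Qed.

Let cV_bigcup (F : (set 'cV[R]_n)^nat) :
  (forall i, g_sigma_preimage coord (F i)) ->
  g_sigma_preimage coord (\bigcup_i F i).
Proof. exact: sigma_algebra_bigcup. Qed.

HB.instance Definition _ :=
  @isMeasurable.Build (measure_tuple_display default_measure_display)
    'cV[R]_n (g_sigma_preimage coord) cV_set0 cV_setC cV_bigcup.

End measurable_cV.

(* Paths and processes are indexed by R, but only times t >= 0 ever matter. *)
Section paths.
Context {R : realType} {n : nat}.

Definition cadlag (f : R -> 'cV[R]_n) : Prop := forall i : 'I_n,
  (forall t : R, 0 <= t -> f s i ord0 @[s --> t^'+] --> f t i ord0) /\
  (forall t : R, 0 < t -> exists l : R, f s i ord0 @[s --> t^'-] --> l).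

(* In skorokhod_compl, F j extends L_j by the value L_j(0) = 0 to negative
   times, so its Stieltjes measure has no atom at 0. *)
Record skorokhod_problem (P : 'M[R]_n) (Y : R -> 'cV[R]_n) (w : 'cV[R]_n)
    (W L : R -> 'cV[R]_n) : Prop := SkorokhodProblem {
  skorokhod_cadlagW : cadlag W ;
  skorokhod_cadlagL : cadlag L ;
  skorokhod_eq : forall t : R, 0 <= t ->
    W t = w + Y t + (1%:M - P^T) *m L t ;
  skorokhod_ge0 : forall t : R, 0 <= t -> forall j, 0 <= W t j ord0 ;
  skorokhod_W0 : W 0 = w ;
  skorokhod_L0 : L 0 = 0 ;
  skorokhod_Lnd : forall s t : R, 0 <= s -> s <= t ->
    forall j, L s j ord0 <= L t j ord0 ;
  skorokhod_compl : exists F : 'I_n -> cumulative R R,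
    (forall j t, F j t = L (Num.max t 0) j ord0) /\
    (\sum_(j < n)
       \int[lebesgue_stieltjes_measure (F j)]_(t in `[0%R, +oo[)
         (W t j ord0)%:E = 0)%E
}.

Record tree_network (r : 'cV[R]_n) (P : 'M[R]_n) : Prop := TreeNetwork {
  tree_rate_gt0 : forall i, 0 < r i ord0 ;
  tree_routing_ge0 : forall i j, 0 <= P i j ;
  tree_routing_diag : forall i, P i i = 0 ;
  tree_routing_sum : forall i, \sum_(j < n) P i j <= 1 ;
  tree_routing_upper : forall i j : 'I_n, (j < i)%N -> P i j = 0 ;
  tree_routing_parent : forall j : 'I_n, (0 < j)%N -> exists! i, 0 < P i j
}.

End paths.

Section processes.
Context {R : realType} {n : nat} {d : measure_display} {T : measurableType d}.
Variable Pr : probability T R.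
Implicit Types Z J : R -> T -> 'cV[R]_n.

Record levy_process J : Prop := LevyProcess {
  levy_measurable : forall t : R, 0 <= t -> measurable_fun setT (J t) ;
  levy_cadlag : forall omega, cadlag (J ^~ omega) ;
  levy_0 : forall omega, J 0 omega = 0 ;
  levy_stationary_increments : forall s t : R, 0 <= s -> 0 <= t ->
    forall A : set 'cV[R]_n, measurable A ->
    Pr ((fun omega => J (s + t) omega - J s omega) @^-1` A) =
    Pr (J t @^-1` A) ;
  levy_independent_increments : forall (k : nat) (t : nat -> R),
    0 <= t 0%N -> (forall i, (i < k)%N -> t i <= t i.+1) ->
    forall A : nat -> set 'cV[R]_n, (forall i, measurable (A i)) ->
    Pr (\bigcap_(i < k)
         ((fun omega => J (t i.+1) omega - J (t i) omega) @^-1` A i)) =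
    (\prod_(i < k)
       Pr ((fun omega => J (t i.+1) omega - J (t i) omega)%R @^-1` A i))%E
}.

Definition stationary_process Z : Prop :=
  (forall t : R, 0 <= t -> measurable_fun setT (Z t)) /\
  (forall (k : nat) (t : nat -> R) (s : R),
     (forall i, 0 <= t i) -> 0 <= s ->
     forall A : nat -> set 'cV[R]_n, (forall i, measurable (A i)) ->
     Pr (\bigcap_(i < k) (Z (t i + s) @^-1` A i)) =
     Pr (\bigcap_(i < k) (Z (t i) @^-1` A i))).

Definition sigma_process Z : set (set T) :=
  <<s \bigcup_(t in [set t : R | 0 <= t])
        preimage_set_system setT (Z t) measurable >>.

Definition independent_of_process (w : T -> 'cV[R]_n) Z : Prop :=
  forall (B : set 'cV[R]_n) (E : set T), measurable B -> sigma_process Z E ->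
  Pr (w @^-1` B `&` E) = (Pr (w @^-1` B) * Pr E)%E.

End processes.

Section fluid_network.
Context {R : realType} {n : nat}.

Definition net_input (r : 'cV[R]_n) (P : 'M[R]_n) (J : R -> 'cV[R]_n)
    (t : R) : 'cV[R]_n :=
  J t - t *: ((1%:M - P^T) *m r).

Definition buffer_content (r : 'cV[R]_n) (P : 'M[R]_n) (J : R -> 'cV[R]_n)
    (w : 'cV[R]_n) (W L : R -> 'cV[R]_n) : Prop :=
  skorokhod_problem P (net_input r P J) w W L.

Context {d : measure_display} {T : measurableType d}.

(* (T, Pr) carries J but in general no w that is independent of J, so the
   random initial content lives on an arbitrary extension proj : T' -> T of
   the probability space; the product of mu and Pr is one such extension. *)
Definition stationary_distribution (Pr : probability T R)
    (J : R -> T -> 'cV[R]_n) (r : 'cV[R]_n) (P : 'M[R]_n)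
    (mu : probability 'cV[R]_n R) : Prop :=
  mu [set x | forall i, 0 <= x i ord0] = 1%E /\
  forall (d' : measure_display) (T' : measurableType d')
    (Pr' : probability T' R) (proj : {mfun T' >-> T})
    (w : {mfun T' >-> 'cV[R]_n}),
  (forall A, measurable A -> distribution Pr' proj A = Pr A) ->
  (forall A, measurable A -> distribution Pr' w A = mu A) ->
  (forall omega i, 0 <= w omega i ord0) ->
  independent_of_process Pr' w (fun t => J t \o proj) ->
  forall W L : R -> T' -> 'cV[R]_n,
  (forall omega, buffer_content r P (J ^~ (proj omega)) (w omega)
     (W ^~ omega) (L ^~ omega)) ->
  stationary_process Pr' W.

Definition free_process (J : R -> T -> 'cV[R]_n) (r : 'cV[R]_n)
    (P : 'M[R]_n) (t : R) (omega : T) : 'cV[R]_n :=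
  invmx (1%:M - P^T) *m J t omega - t *: r.

Definition free_values (J : R -> T -> 'cV[R]_n) (r : 'cV[R]_n)
    (P : 'M[R]_n) (omega : T) (k : 'I_n) : set R :=
  [set free_process J r P t omega k ord0 | t in [set t : R | 0 <= t]].

(* [sup] is 0 by convention on unbounded sets. *)
Definition free_sup (J : R -> T -> 'cV[R]_n) (r : 'cV[R]_n)
    (P : 'M[R]_n) (omega : T) : 'cV[R]_n :=
  \col_k sup (free_values J r P omega k).

End fluid_network.

(* Main.v *)
(* Put X = Q J - r t and V = Q W with Q = (I - P')^-1.  For a queue j with
   parent i, (T1) and (T2) make X_j - p_ij X_i nondecreasing, so each V_j is the
   one-dimensional reflection at 0 of X_j started from (Q w)_j:
     V_j(t) = max ((Q w)_j + X_j(t), sup_(u <= t) (X_j(t) - X_j(u))).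
   Hence V(s + t) is the same functional of V(s) and of the increments of J after
   s.  Reversing time on [0, s] turns V(s) into max (Q w + X(s), sup_(u <= s) X(u))
   in law, and if Q w has the law of sup X this is again the law of sup X, by the
   Markov property.  Finiteness of sup X comes from the maximal ergodic argument
   at integer times and Ottaviani's inequality.  For uniqueness, drive the
   contents started from two stationary laws by the same J: since X tends to
   -oo they eventually coincide. *)

(* The complementarity condition pairs L_j with W_j and not with V_j, so the reflection formula is
   not immediate. It rests on p_ij V_i <= V_j, inherited from the monotonicity of X_j - p_ij X_i. As
   W_j = V_j - p_ij V_i, this gives 0 <= W_j <= V_j, which settles existence; once the parent is
   known, it also gives W_j >= L_j - R_j, with R_j the one-dimensional regulator, which settles
   uniqueness. On the probabilistic side the obstacle is measurability: path space carries the
   product sigma-algebra, for which a supremum over uncountably many times need not be measurable.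
   Contents and suprema are therefore written with dyadic times only, as measurable functionals that
   agree with the true ones on the paths at hand. Laws are then compared on cylinders and
   rectangles, always for a pair of a state and a path. That X tends to -oo is obtained without a
   law of large numbers: boundedness of the walk at integer times, applied with smaller drain rates,
   leaves a linear margin. *)
Require Import Defs.
From HB Require Import structures.
From mathcomp Require Import all_boot all_order all_algebra.
From mathcomp Require Import all_classical all_reals all_analysis.
From mathcomp Require Import measurable_realfun ring lra.
Import Order.TTheory GRing.Theory Num.Theory.
Import numFieldTopology.Exports numFieldNormedType.Exports.

Local Open Scope classical_set_scope.
Local Open Scope ring_scope.

Set Implicit Arguments.
Unset Strict Implicit.
Unset Printing Implicit Defensive.

(** * Laws on product spaces *)

(** Dynkin's pi-lambda argument: in [A], both sides are finite measures, namely the law of [f1]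
    restricted to [H] and [c] times the law of [f2]. *)
Lemma eq_law_generator d1 d2 d3 (T1 : measurableType d1) (T2 : measurableType d2)
    (S : measurableType d3) (R : realType) (P1 : probability T1 R)
    (P2 : probability T2 R) (f1 : T1 -> S) (f2 : T2 -> S) (H : set T1) (c : \bar R)
    (G : set (set S)) :
  measurable_fun setT f1 -> measurable_fun setT f2 -> measurable H ->
  (0 <= c)%E -> c \is a fin_num ->
  measurable = <<s G >> -> setI_closed G -> G setT ->
  (forall A, G A -> P1 (f1 @^-1` A `&` H) = c * P2 (f2 @^-1` A))%E ->
  forall A, measurable A -> P1 (f1 @^-1` A `&` H) = (c * P2 (f2 @^-1` A))%E.
Proof.
move=> mf1 mf2 mH c0 cfin mG GI GT eqG A mA.
have nc : 0 <= fine c by exact: fine_ge0.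
pose m1 := (pushforward (mrestr P1 mH) f1 : {measure set S -> \bar R}).
pose p2 := (pushforward P2 f2 : {measure set S -> \bar R}).
pose m2 : {measure set S -> \bar R} := mscale (NngNum nc) (p2 mf2).
suff : m1 mf1 A = m2 A by rewrite /m1 /m2 /= /mscale/= fineK.
apply: (measure_unique G (fun=> setT) _ _ _ _ (m1 mf1) m2) => //.
- by rewrite -subTset => x _; exists 0%N.
- by move=> B GB; rewrite /m1 /m2 /= /mscale/= fineK//; exact: eqG.
- move=> _; rewrite /m1 /= /pushforward /mrestr preimage_setT setTI.
  by rewrite (le_lt_trans (probability_le1 P1 mH)) ?ltry.
Qed.

(** An alias, so that the product sigma-algebra below is attached to it and not to every function
    type. *)
Definition fspace (I E : Type) : Type := I -> E.

(** Closed by [Qed], hence opaque: the display of path space does not unfold to that of [E]. *)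
Definition fspace_display : measure_display -> measure_display.
Proof. exact. Qed.

Section fspace_measurable.
Context (I : pointedType) d (E : measurableType d).

Definition fspace_gen : set (set (fspace I E)) :=
  \bigcup_i preimage_set_system setT (fun f : fspace I E => f i) measurable.

HB.instance Definition _ := Pointed.on (fspace I E).

Let fs_set0 : <<s fspace_gen >> set0.
Proof. exact: sigma_algebra0. Qed.

Let fs_setC A : <<s fspace_gen >> A -> <<s fspace_gen >> (~` A).
Proof. exact: sigma_algebraC. Qed.

Let fs_bigcup (F : (set (fspace I E))^nat) :
  (forall i, <<s fspace_gen >> (F i)) -> <<s fspace_gen >> (\bigcup_i F i).
Proof. exact: sigma_algebra_bigcup. Qed.

HB.instance Definition _ := @isMeasurable.Build (fspace_display d)
  (fspace I E) <<s fspace_gen >> fs_set0 fs_setC fs_bigcup.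

Lemma measurable_eval (i : I) : measurable_fun setT (fun f : fspace I E => f i).
Proof.
move=> _ A mA; apply: sub_sigma_algebra; exists i => //; exists A => //.
Qed.

Lemma measurable_fun_fspace d' (T : measurableType d') (g : T -> fspace I E) :
  (forall i, measurable_fun setT (fun x => g x i)) -> measurable_fun setT g.
Proof.
move=> mg; apply: (@measurability _ _ _ _ _ _ fspace_gen) => //.
move=> _ [_ [i _ [A mA <-]] <-]; rewrite !setTI.
by rewrite -[X in measurable X]setTI; exact: mg.
Qed.

Definition cylinder (k : nat) (t : nat -> I) (A : nat -> set E) :
  set (fspace I E) := \bigcap_(i < k) [set f | A i (f (t i))].

Definition cylinders : set (set (fspace I E)) :=
  [set C | exists k t A, (forall i, measurable (A i)) /\ C = cylinder k t A].

Lemma cylinders_gen : measurable = <<s cylinders >>.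
Proof.
apply/seteqP; split.
  apply: smallest_sub; first exact: smallest_sigma_algebra.
  move=> _ [i _ [A mA <-]]; apply: sub_sigma_algebra.
  exists 1%N, (fun=> i), (fun=> A); split => //; rewrite setTI.
  by apply/seteqP; split => [f Af _ _//|f /(_ 0%N erefl)].
apply: smallest_sub; first exact: sigma_algebra_measurable.
move=> _ [k [t [A [mA ->]]]].
apply: bigcap_measurableType => i _.
have := @measurable_eval (t i) measurableT (A i) (mA i).
by rewrite setTI.
Qed.

Lemma cylinders_setI : setI_closed cylinders.
Proof.
move=> _ _ [k1 [t1 [A1 [mA1 ->]]]] [k2 [t2 [A2 [mA2 ->]]]].
exists (k1 + k2)%N, (fun i => if (i < k1)%N then t1 i else t2 (i - k1)%N),
  (fun i => if (i < k1)%N then A1 i else A2 (i - k1)%N).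
split; first by move=> i; case: ifP.
apply/seteqP; split => [f [h1 h2] i /= ik|f h].
  case: ifPn => ik1; first exact: h1.
  by apply: h2; rewrite /= ltn_subLR// leqNgt.
split => i /= ik.
  by have := h i; rewrite /= ik; apply; exact: (leq_trans ik (leq_addr _ _)).
by have := h (k1 + i)%N; rewrite /= ltn_add2l (ltnNge _ k1) leq_addr /= addKn; apply.
Qed.

Lemma cylinders_setT : cylinders setT.
Proof.
by exists 0%N, point, (fun=> setT); split => //; apply/seteqP; split.
Qed.

End fspace_measurable.

Lemma eq_law_prod d1 d2 d3 d4 (T1 : measurableType d1) (T2 : measurableType d2)
    (S : measurableType d3) (S' : measurableType d4) (R : realType)
    (P1 : probability T1 R) (P2 : probability T2 R)
    (f1 : T1 -> S) (g1 : T1 -> S') (f2 : T2 -> S) (g2 : T2 -> S')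
    (H : set T1) (c : \bar R) :
  measurable_fun setT f1 -> measurable_fun setT f2 ->
  measurable_fun setT g1 -> measurable_fun setT g2 -> measurable H ->
  (0 <= c)%E -> c \is a fin_num ->
  (forall A B, measurable A -> measurable B ->
    P1 (f1 @^-1` A `&` g1 @^-1` B `&` H) = c * P2 (f2 @^-1` A `&` g2 @^-1` B))%E ->
  forall C, measurable C ->
    P1 ((fun x => (f1 x, g1 x)) @^-1` C `&` H) =
    (c * P2 ((fun x => (f2 x, g2 x)) @^-1` C))%E.
Proof.
move=> mf1 mf2 mg1 mg2 mH c0 cfin h.
apply: (@eq_law_generator _ _ _ _ _ _ _ _ _ _ _ _ _
  [set A `*` B | A in measurable & B in measurable]) => //.
- exact: measurable_fun_pair.
- exact: measurable_fun_pair.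
- exact: measurable_prod_measurableType.
- move=> _ _ [A1 mA1 [B1 mB1 <-]] [A2 mA2 [B2 mB2 <-]].
  exists (A1 `&` A2); first exact: measurableI.
  by exists (B1 `&` B2); [exact: measurableI|rewrite setXI].
- by exists setT => //; exists setT => //; rewrite setXTT.
- by move=> _ [A mA [B mB <-]]; rewrite -h.
Qed.

Lemma eq_law_prodT d1 d2 d3 d4 (T1 : measurableType d1) (T2 : measurableType d2)
    (S : measurableType d3) (S' : measurableType d4) (R : realType)
    (P1 : probability T1 R) (P2 : probability T2 R)
    (f1 : T1 -> S) (g1 : T1 -> S') (f2 : T2 -> S) (g2 : T2 -> S') :
  measurable_fun setT f1 -> measurable_fun setT f2 ->
  measurable_fun setT g1 -> measurable_fun setT g2 ->
  (forall A B, measurable A -> measurable B ->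
    P1 (f1 @^-1` A `&` g1 @^-1` B) = P2 (f2 @^-1` A `&` g2 @^-1` B))%E ->
  forall C, measurable C ->
    P1 ((fun x => (f1 x, g1 x)) @^-1` C) = P2 ((fun x => (f2 x, g2 x)) @^-1` C).
Proof.
move=> mf1 mf2 mg1 mg2 h C mC.
rewrite -[X in P1 X]setIT -[RHS]mul1e.
by apply: eq_law_prod => // A B mA mB; rewrite setIT mul1e; exact: h.
Qed.

(** A cylinder may name its indices repeatedly and in any order. Regrouped by index it becomes a
    condition on the first [K] coordinates, the form in which independence of increments is
    stated. *)
Lemma cylinder_natE d (E : measurableType d) k (t : nat -> nat) (A : nat -> set E) :
  (forall i, measurable (A i)) ->
  exists K B, (forall l, measurable (B l)) /\
    cylinder k t A = \bigcap_(l < K) [set f | B l (f l)].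
Proof.
(* [K] is one more than the largest index named; an index that is never named gets an empty
   intersection, which is the whole space. *)
move=> mA; exists (\max_(i < k) (t i).+1)%N,
  (fun l => \bigcap_(i in [set i | (i < k)%N /\ t i = l]) A i).
split; first by move=> l; apply: bigcap_measurableType => i _.
apply/seteqP; split => [f h l _ i [ik <-]|f h i /= ik]; first exact: h.
have := h (t i); apply => //=.
have := @leq_bigmax _ (fun i : 'I_k => (t i).+1) (Ordinal ik); exact.
Qed.

Section cV_measurable.
Context (R : realType) (n : nat).

Lemma measurable_coord (j : 'I_n) : measurable_fun setT (fun x : 'cV[R]_n => x j ord0).
Proof.
move=> _ A mA; apply: sub_sigma_algebra; rewrite setTI.
by rewrite -bigcup_seq; exists j; [rewrite /= mem_index_enum|exists A => //; rewrite setTI].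
Qed.

Lemma measurable_fun_cV d (T : measurableType d) (g : T -> 'cV[R]_n) :
  (forall j, measurable_fun setT (fun x => g x j ord0)) -> measurable_fun setT g.
Proof.
move=> mg; apply: (@measurability _ _ _ _ _ _
  (\big[setU/set0]_(i < n) preimage_set_system setT
    (fun x : 'cV[R]_n => x i ord0) measurable)) => //.
move=> X [B]; rewrite -bigcup_seq => -[i _ [A mA <-]] <-; rewrite !setTI.
by rewrite -[X in measurable X]setTI; exact: mg.
Qed.

Lemma measurable_cVB d (T : measurableType d) (f g : T -> 'cV[R]_n) :
  measurable_fun setT f -> measurable_fun setT g ->
  measurable_fun setT (fun x => f x - g x).
Proof.
move=> mf mg; apply: measurable_fun_cV => j.
rewrite (_ : (fun _ => _) = (fun x => f x j ord0 - g x j ord0)); last first.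
  by apply/funext => x; rewrite !mxE.
by apply: measurable_funB; apply: (measurableT_comp (measurable_coord j)).
Qed.

Lemma measurable_cV_sum d (T : measurableType d) k (f : nat -> T -> 'cV[R]_n) :
  (forall i, measurable_fun setT (f i)) ->
  measurable_fun setT (fun x => \sum_(i < k) f i x).
Proof.
move=> mf; apply: measurable_fun_cV => j.
rewrite (_ : (fun _ => _) = (fun x => \sum_(i < k) f i x j ord0)); last first.
  by apply/funext => x; rewrite summxE.
by apply: measurable_sum => i; apply: (measurableT_comp (measurable_coord j)).
Qed.

Lemma measurable_mulmxl d (T : measurableType d) (A : 'M[R]_n) (f : T -> 'cV[R]_n) :
  measurable_fun setT f -> measurable_fun setT (fun x => A *m f x).
Proof.
move=> mf; apply: measurable_fun_cV => j.
rewrite (_ : (fun _ => _) = (fun x => \sum_i A j i * f x i ord0)); last first.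
  by apply/funext => x; rewrite mxE.
apply: measurable_sum => i; apply: measurable_funM => //.
by apply: (measurableT_comp (measurable_coord i)).
Qed.

End cV_measurable.

(** * Levy processes on path space *)

Section law_of_increments.
Context (R : realType) (n : nat) d1 d2 (T1 : measurableType d1)
  (T2 : measurableType d2) (P1 : probability T1 R) (P2 : probability T2 R).
Local Notation E := 'cV[R]_n.
Variables (D : set R) (Z1 : R -> T1 -> E) (Z2 : R -> T2 -> E) (H : set T1) (c : \bar R).
Hypotheses (D0 : D 0) (Dge0 : forall t, D t -> 0 <= t).
Hypotheses (mZ1 : forall t, D t -> measurable_fun setT (Z1 t))
  (mZ2 : forall t, D t -> measurable_fun setT (Z2 t)).
Hypotheses (Z10 : forall x, Z1 0 x = 0) (Z20 : forall x, Z2 0 x = 0).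
Hypotheses (mH : measurable H) (c0 : (0 <= c)%E) (cfin : c \is a fin_num).

(* The values at finitely many times are partial sums of the increments along
   the sorted times.  The event [H] and the factor [c] give equality in law when
   [H] is everything, and independence from [H] when [c] is its probability. *)
Lemma law_of_increments :
  (forall (t : nat -> R), (forall i, D (t i)) -> (forall i, t i <= t i.+1) ->
   forall k (A : nat -> set E), (forall i, measurable (A i)) ->
   P1 (\bigcap_(i < k) ((fun x => Z1 (t i.+1) x - Z1 (t i) x) @^-1` A i) `&` H) =
   (c * P2 (\bigcap_(i < k) ((fun x => (Z2 (t i.+1) x - Z2 (t i) x)%R) @^-1` A i)))%E) ->
  forall (cl : R -> R), (forall t, D (cl t)) ->
  forall C : set (fspace R E), measurable C ->
  P1 ((fun x => (fun t => Z1 (cl t) x) : fspace R E) @^-1` C `&` H) =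
  (c * P2 ((fun x => (fun t => Z2 (cl t) x) : fspace R E) @^-1` C))%E.
Proof.
move=> hinc cl Dcl; apply: (@eq_law_generator _ _ _ _ _ _ _ _ _ _ _ _ _ (@cylinders R _ E)) => //.
- by apply: measurable_fun_fspace => t; exact: mZ1.
- by apply: measurable_fun_fspace => t; exact: mZ2.
- exact: cylinders_gen.
- exact: cylinders_setI.
- exact: cylinders_setT.
move=> _ [k [u [A [mA ->]]]].
(* Time 0 is added so that the partial sums start at a value known to vanish. *)
pose s := sort <=%R (0 :: [seq cl (u i) | i <- iota 0 k]).
pose k0 := (size s).-1.
(* Constant after the last sorted time: the hypothesis on increments wants an infinite nondecreasing
   sequence. *)
pose tau l := nth 0 s (minn l k0).
have ss : size s = k0.+1 by rewrite /k0 size_sort.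
have tsrt : sorted <=%R s by apply: sort_sorted; exact: le_total.
have taunth l : (l <= k0)%N -> tau l = nth 0 s l by move=> lk; rewrite /tau (minn_idPl lk).
have sD x : x \in s -> D x.
  by rewrite mem_sort inE => /predU1P[->//|/mapP[i _ ->]]; exact: Dcl.
have tauD l : D (tau l) by apply: sD; apply: mem_nth; rewrite ss ltnS geq_minr.
have taund l : tau l <= tau l.+1.
  apply: (sorted_leq_nth le_trans le_refl) => //.
  - by rewrite inE ss ltnS geq_minr.
  - by rewrite inE ss ltnS geq_minr.
  - by rewrite leq_min geq_minr andbT geq_min leqnSn.
have tau0 : tau 0%N = 0.
  have s0 : 0 \in s by rewrite mem_sort inE eqxx.
  apply/eqP; rewrite eq_le Dge0// andbT taunth// -[leRHS](nth_index 0 s0).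
  by apply: (sorted_leq_nth le_trans le_refl) => //; rewrite inE ?ss// -ss index_mem.
have Zsum d (T : measurableType d) (Z : R -> T -> E) (Z0 : forall x, Z 0 x = 0) x i :
    (i < k)%N -> Z (cl (u i)) x =
     \sum_(l < index (cl (u i)) s) (Z (tau l.+1) x - Z (tau l) x).
  move=> ik; have us : cl (u i) \in s.
    by rewrite mem_sort inE; apply/orP; right; apply: map_f; rewrite mem_iota.
  rewrite -(big_mkord xpredT (fun l => Z (tau l.+1) x - Z (tau l) x)) telescope_sumr//.
  by rewrite tau0 Z0 subr0 taunth ?nth_index// -ltnS -ss index_mem.
pose xi d (T : measurableType d) (Z : R -> T -> E) : T -> fspace nat E :=
  fun x l => Z (tau l.+1) x - Z (tau l) x.
(* The position of [cl (u i)] in the sorted list is the number of increments that add up to the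
   value at that time. *)
pose B : set (fspace nat E) := \bigcap_(i < k)
  [set f : fspace nat E | A i (\sum_(l < index (cl (u i)) s) f l)].
have mB : measurable B.
  apply: bigcap_measurableType => i _.
  have := @measurable_cV_sum R n _ (fspace nat E) (index (cl (u i)) s)
     (fun l f => f l) (fun l => @measurable_eval _ _ _ l) measurableT (A i) (mA i).
  by rewrite setTI.
have cylE d (T : measurableType d) (Z : R -> T -> E) (Z0 : forall x, Z 0 x = 0) :
   (fun x => (fun t => Z (cl t) x) : fspace R E) @^-1` (cylinder k u A) = xi _ _ Z @^-1` B.
  apply/seteqP; split => x h i /= ik.
    by have := h i ik; rewrite /= Zsum.
  by rewrite Zsum//; exact: (h i ik).
rewrite !cylE//.
have mxi d (T : measurableType d) (Z : R -> T -> E)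
    (mZ : forall t, D t -> measurable_fun setT (Z t)) :
   measurable_fun setT (xi _ _ Z).
  by apply: measurable_fun_fspace => l; apply: measurable_cVB; exact: mZ.
apply: (@eq_law_generator _ _ _ _ _ _ _ _ _ _ _ _ _ (@cylinders nat _ E)) => //.
- exact: mxi.
- exact: mxi.
- exact: cylinders_gen.
- exact: cylinders_setI.
- exact: cylinders_setT.
move=> _ [k' [t' [A' [mA' ->]]]].
have [K [B' [mB' ->]]] := cylinder_natE k' t' mA'.
rewrite !preimage_bigcap; exact: hinc.
Qed.

End law_of_increments.

(** Paths are functions on all of [R], but only nonnegative times, or those in [0, s], are
    meaningful. [tpos] and [tclip] send any index to such a time, so that every coordinate of a path
    is measurable. *)
Definition tpos (R : realType) (t : R) : R := Num.max t 0.
Definition tclip (R : realType) (s t : R) : R := Num.min s (tpos t).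

Lemma tpos_ge0 (R : realType) (t : R) : 0 <= tpos t.
Proof. by rewrite /tpos le_max lexx orbT. Qed.

Lemma tpos_id (R : realType) (t : R) : 0 <= t -> tpos t = t.
Proof. by move=> t0; apply/max_idPl. Qed.

Lemma tclip_itv (R : realType) (s t : R) : 0 <= s -> 0 <= tclip s t <= s.
Proof. by move=> s0; rewrite /tclip le_min s0 tpos_ge0 ge_min lexx. Qed.

Lemma tclip_id (R : realType) (s t : R) : 0 <= t <= s -> tclip s t = t.
Proof. by move=> /andP[t0 ts]; rewrite /tclip tpos_id//; apply/min_idPr. Qed.

Lemma subBB (V : zmodType) (a b c : V) : (c - a) - (c - b) = b - a.
Proof. by rewrite opprB addrC addrA subrK. Qed.

Section levy_laws.
Context (R : realType) (n : nat) d (T : measurableType d) (Pr : probability T R).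
Local Notation E := 'cV[R]_n.
Variable J : R -> T -> E.
Hypothesis HJ : levy_process Pr J.

Definition path_of (x : T) : fspace R E := fun t => J (tpos t) x.
Definition stop_of (s : R) (x : T) : fspace R E := fun t => J (tclip s t) x.
Definition shift_of (s : R) (x : T) : fspace R E := fun t => J (s + tpos t) x - J s x.
(** The value at [s - t] is not a left limit, so on (0, s] this path is left-continuous instead of
    cadlag. Only its law matters, and [content_Ufun] relies on the right continuity of the original
    path. *)
Definition rev_of (s : R) (x : T) : fspace R E :=
  fun t => J s x - J (s - tclip s t) x.

Lemma measurable_path_of : measurable_fun setT path_of.
Proof. by apply: measurable_fun_fspace => t; apply: (levy_measurable HJ); exact: tpos_ge0. Qed.

Lemma measurable_shift_of s : 0 <= s -> measurable_fun setT (shift_of s).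
Proof.
move=> s0; apply: measurable_fun_fspace => t; apply: measurable_cVB;
  apply: (levy_measurable HJ) => //; by rewrite addr_ge0// tpos_ge0.
Qed.

Lemma measurable_stop_of s : 0 <= s -> measurable_fun setT (stop_of s).
Proof.
move=> s0; apply: measurable_fun_fspace => t; apply: (levy_measurable HJ).
by case/andP: (tclip_itv t s0).
Qed.

Lemma measurable_rev_of s : 0 <= s -> measurable_fun setT (rev_of s).
Proof.
move=> s0; apply: measurable_fun_fspace => t; apply: measurable_cVB;
  apply: (levy_measurable HJ) => //; rewrite subr_ge0.
by case/andP: (tclip_itv t s0).
Qed.

Lemma measurable_incr s t : 0 <= s -> 0 <= t ->
  measurable_fun setT (fun x => J t x - J s x).
Proof. by move=> s0 t0; apply: measurable_cVB; exact: (levy_measurable HJ). Qed.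

Lemma measurable_incr_event k (u v : nat -> R) (A : nat -> set E) :
  (forall i, 0 <= u i) -> (forall i, 0 <= v i) -> (forall i, measurable (A i)) ->
  measurable (\bigcap_(i < k) ((fun x => J (u i) x - J (v i) x) @^-1` A i)).
Proof.
move=> u0 v0 mA; apply: bigcap_measurableType => i _.
rewrite -[X in measurable X]setTI.
exact: (measurable_incr (v0 i) (u0 i) measurableT (mA i)).
Qed.

Lemma levy_incr (t : nat -> R) k (A : nat -> set E) :
  (forall i, 0 <= t i) -> (forall i, t i <= t i.+1) ->
  (forall i, measurable (A i)) ->
  Pr (\bigcap_(i < k) ((fun x => J (t i.+1) x - J (t i) x) @^-1` A i)) =
  (\prod_(i < k) Pr (J (t i.+1 - t i) @^-1` A i))%E.
Proof.
move=> t0 tnd mA; rewrite (levy_independent_increments HJ)//.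
apply: eq_bigr => i _.
rewrite -(levy_stationary_increments HJ (t0 i) _ (mA i)) ?subr_ge0//.
by rewrite addrC subrK.
Qed.

Lemma levy_shift s C : 0 <= s -> measurable C ->
  Pr (shift_of s @^-1` C) = Pr (path_of @^-1` C).
Proof.
move=> s0 mC.
have := @law_of_increments R n _ _ T T Pr Pr [set t | 0 <= t]
  (fun t x => J (s + t) x - J s x) J setT 1%E (lexx _) (fun t => id)
  _ _ _ _ _ _ _ _ (@tpos R) _ C mC; rewrite setIT mul1e; apply => //.
- by move=> t /= t0; apply: measurable_incr => //; exact: addr_ge0.
- by move=> t /=; exact: (levy_measurable HJ).
- by move=> x; rewrite addr0 subrr.
- by move=> x; exact: (levy_0 HJ).
- move=> t t0 tnd k A mA; rewrite setIT mul1e levy_incr//.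
  transitivity (Pr (\bigcap_(i < k)
      ((fun x => J (s + t i.+1) x - J (s + t i) x) @^-1` A i))).
    congr (Pr _); apply: eq_bigcapr => i _; apply: (congr1 (fun f => f @^-1` A i)).
    by apply/funext => x; rewrite opprB addrA subrK.
  rewrite (@levy_incr (fun i => s + t i))//.
  + by apply: eq_bigr => i _; rewrite opprD addrACA subrr add0r.
  + by move=> i; rewrite addr_ge0//; exact: t0.
  + by move=> i; rewrite lerD2l.
- by move=> t; exact: tpos_ge0.
Qed.

(** The increments of the reversed path are those of [J] over the mirrored intervals, of the same
    lengths and in opposite order; their joint law is a product that depends on the lengths only. *)
Lemma levy_rev s C : 0 <= s -> measurable C ->
  Pr (rev_of s @^-1` C) = Pr (stop_of s @^-1` C).
Proof.
move=> s0 mC.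
have := @law_of_increments R n _ _ T T Pr Pr [set t | 0 <= t <= s]
  (fun t x => J s x - J (s - t) x) J setT 1%E _ _
  _ _ _ _ _ _ _ _ (@tclip R s) _ C mC; rewrite setIT mul1e; apply => //.
- by rewrite /= lexx.
- by move=> t /andP[].
- by move=> t /= /andP[t0 ts]; apply: measurable_incr => //; rewrite subr_ge0.
- by move=> t /= /andP[t0 ts]; exact: (levy_measurable HJ).
- by move=> x; rewrite subr0 subrr.
- by move=> x; exact: (levy_0 HJ).
- move=> t t0s tnd k A mA; rewrite setIT mul1e.
  have t0 i : 0 <= t i by case/andP: (t0s i).
  have ts i : t i <= s by case/andP: (t0s i).
  rewrite levy_incr//.
  (* Counting backwards makes the mirrored times increase again; truncated subtraction keeps [u]
     constant after index [k]. *)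
  pose u m := s - t (k - m)%N.
  transitivity (Pr (\bigcap_(i < k)
      ((fun x => J (u i.+1) x - J (u i) x) @^-1` A (k - i.+1)%N))).
    congr (Pr _); rewrite /u; apply/seteqP; split => x h i /= ik.
      have := h (k - i.+1)%N; rewrite /= -subSn// subSS leq_subr => /(_ erefl).
      rewrite !subBB; exact.
    have := h (k - i.+1)%N; rewrite /= -subSn// subSS leq_subr => /(_ erefl).
    rewrite !subKn//; last exact: ltnW.
    rewrite !subBB; exact.
  rewrite (@levy_incr u)//.
  + rewrite [RHS](reindex_inj rev_ord_inj) /=; apply: eq_bigr => i _.
    by rewrite subnSK// /u subBB.
  + by move=> i; rewrite /u subr_ge0.
  + move=> i; rewrite /u lerD2l lerN2.
    have [ik|ki] := ltnP i k; first by rewrite -(subnSK ik).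
    have h1 : (k - i = 0)%N by apply/eqP; rewrite subn_eq0.
    have h2 : (k - i.+1 = 0)%N by apply/eqP; rewrite subn_eq0 leqW.
    by rewrite h1 h2.
- by move=> t /=; exact: tclip_itv.
Qed.

(** Two passages from increments to path events: first the future is a finite family of increments
    and the past becomes arbitrary, then this past is the fixed event and the future becomes
    arbitrary. *)
Lemma levy_stop_shift s C1 C2 : 0 <= s -> measurable C1 -> measurable C2 ->
  Pr (stop_of s @^-1` C1 `&` shift_of s @^-1` C2) =
  (Pr (stop_of s @^-1` C1) * Pr (shift_of s @^-1` C2))%E.
Proof.
move=> s0 mC1 mC2.
have shifts (u : nat -> R) k (A : nat -> set E) : (forall i, 0 <= u i) ->
    (forall i, u i <= u i.+1) -> (forall i, measurable (A i)) ->
    let H := \bigcap_(i < k) ((fun x => J (s + u i.+1) x - J (s + u i) x) @^-1` A i) in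
    Pr (stop_of s @^-1` C1 `&` H) = (Pr (stop_of s @^-1` C1) * Pr H)%E.
  move=> u0 und mA H.
  have mH : measurable H.
    by apply: (@measurable_incr_event _ (fun i => s + u i.+1) (fun i => s + u i)) => // i;
      exact: addr_ge0.
  rewrite [RHS]muleC.
  apply: (@law_of_increments R n _ _ T T Pr Pr [set t | 0 <= t <= s] J J H (Pr H)) => //.
  - by rewrite /= lexx.
  - by move=> t /andP[].
  - by move=> t /= /andP[t0 ts]; exact: (levy_measurable HJ).
  - by move=> t /= /andP[t0 ts]; exact: (levy_measurable HJ).
  - by move=> x; exact: (levy_0 HJ).
  - by move=> x; exact: (levy_0 HJ).
  - exact: fin_num_measure.
  - move=> t t0s tnd k' A' mA'.
    have t0 i : 0 <= t i by case/andP: (t0s i).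
    have ts i : t i <= s by case/andP: (t0s i).
    (* Past times up to index [k'], followed by the future times; the increment that bridges them,
       number [k'], is left unconstrained by [B k' = setT]. *)
    pose v i := if (i <= k')%N then t i else s + u (i - k'.+1)%N.
    pose B i := if (i < k')%N then A' i else if i == k' then setT else A (i - k'.+1)%N.
    have vE1 i : (i < k'.+1)%N -> v i = t i by move=> ik; rewrite /v -ltnS ik.
    have vE2 i : v (k'.+1 + i)%N = s + u i.
      by rewrite /v leqNgt leq_addr /= addKn.
    have BE1 i : (i < k')%N -> B i = A' i by rewrite /B => ->.
    have BE2 i : B (k'.+1 + i)%N = A i.
      rewrite /B ltnNge (leq_trans _ (leq_addr _ _))//= addKn.
      by rewrite gtn_eqF// leq_addr.
    have BE3 : B k' = setT by rewrite /B ltnn eqxx.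
    have v0 i : 0 <= v i by rewrite /v; case: ifP => _ //; rewrite addr_ge0.
    have vnd i : v i <= v i.+1.
      have [ik|ik|ik] := ltngtP i k'.
      + by rewrite !vE1// ltnS ltnW.
      + by rewrite -(subnKC ik) -addnS !vE2 lerD2l.
      + by rewrite ik vE1// -[k'.+1]addn0 vE2 (le_trans (ts _))// lerDl.
    have mB i : measurable (B i) by rewrite /B; case: ifP => // _; case: ifP.
    rewrite (_ : _ `&` H = \bigcap_(i < (k'.+1 + k)%N)
        ((fun x => J (v i.+1) x - J (v i) x) @^-1` B i)); last first.
      apply/seteqP; split => [x [h1 h2] i /= ik|x h].
        have [ik'|ki'|->] := ltngtP i k'; last by rewrite BE3.
          by rewrite BE1// !vE1//; [exact: h1|rewrite ltnS ltnW].
        move: ik; rewrite -(subnKC ki') ltn_add2l -addnS !vE2 BE2 => ik; exact: h2.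
      split => i /= ik.
        have := h i; rewrite /= BE1// !vE1//; last by rewrite ltnS ltnW.
        by apply; rewrite (leq_trans ik)// addSnnS leq_addr.
      by have := h (k'.+1 + i)%N; rewrite /= ltn_add2l BE2 -addnS !vE2; apply.
    rewrite (levy_independent_increments HJ)// big_split_ord /=.
    rewrite big_ord_recr/= BE3 preimage_setT probability_setT mule1.
    rewrite muleC; congr (_ * _)%E.
      rewrite /H (levy_independent_increments HJ (t := fun i => s + u i))//.
      + by apply: eq_bigr => i _; rewrite BE2 -addnS !vE2.
      + by rewrite addr_ge0.
      + by move=> i _; rewrite lerD2l.
    rewrite (levy_independent_increments HJ)//.
    apply: eq_bigr => i _.
    by rewrite BE1// !vE1// ltnS ?ltn_ord// ltnW.
  - by move=> t; exact: tclip_itv.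
have mS : measurable (stop_of s @^-1` C1).
  by rewrite -[X in measurable X]setTI; exact: measurable_stop_of.
rewrite setIC.
apply: (@law_of_increments R n _ _ T T Pr Pr [set t | 0 <= t]
  (fun t x => J (s + t) x - J s x) (fun t x => J (s + t) x - J s x)
   (stop_of s @^-1` C1) (Pr (stop_of s @^-1` C1))) => //.
- by rewrite /= lexx.
- by move=> t /= t0; apply: measurable_incr => //; exact: addr_ge0.
- by move=> t /= t0; apply: measurable_incr => //; exact: addr_ge0.
- by move=> x; rewrite addr0 subrr.
- by move=> x; rewrite addr0 subrr.
- exact: fin_num_measure.
- move=> t t0 tnd k A mA; rewrite setIC.
  rewrite (_ : \bigcap_(i < k) _ = \bigcap_(i < k)
      ((fun x => J (s + t i.+1) x - J (s + t i) x) @^-1` A i)); last first.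
    apply: eq_bigcapr => i _; apply: (congr1 (fun f => f @^-1` A i)).
    by apply/funext => x; rewrite opprB addrA subrK.
  exact: shifts.
- by move=> t; exact: tpos_ge0.
Qed.

End levy_laws.

Lemma measurable_preimage d1 d2 (T1 : measurableType d1) (T2 : measurableType d2)
  (f : T1 -> T2) (A : set T2) :
  measurable_fun setT f -> measurable A -> measurable (f @^-1` A).
Proof. by move=> mf mA; rewrite -[X in measurable X]setTI; exact: mf. Qed.

Section independent_initial_state.
Context (R : realType) (n : nat) d (T : measurableType d) (Pr : probability T R).
Local Notation E := 'cV[R]_n.
Variables (J : R -> T -> E).
Hypothesis HJ : levy_process Pr J.

Definition indep_path (w : T -> E) : Prop :=
  forall B (C : set (fspace R E)), measurable B -> measurable C ->
  Pr (w @^-1` B `&` path_of J @^-1` C) = (Pr (w @^-1` B) * Pr (path_of J @^-1` C))%E.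

(** [path_of J] is already measurable for the sigma-algebra generated by the process, so path events
    belong to [sigma_process]. *)
Lemma independent_indep_path (w : T -> E) :
  independent_of_process Pr w J -> indep_path w.
Proof.
move=> ind B C mB mC; apply: ind => //; rewrite /sigma_process; set G := (X in <<s X >>).
have mp : measurable_fun (setT : set (g_sigma_algebraType G)) (path_of J).
  apply: measurable_fun_fspace => t _ A mA; rewrite setTI.
  apply: sub_sigma_algebra; exists (tpos t); first exact: tpos_ge0.
  by exists A => //; rewrite setTI.
exact: (measurable_preimage mp mC).
Qed.

Variable w : T -> E.
Hypotheses (mw : measurable_fun setT w) (wJ : indep_path w).

Definition path_stop (s : R) (p : fspace R E) : fspace R E := fun t => p (tclip s t).
Definition path_shift (s : R) (p : fspace R E) : fspace R E :=
  fun t => p (s + tpos t) - p s.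
Definition path_rev (s : R) (p : fspace R E) : fspace R E :=
  fun t => p s - p (s - tclip s t).

Lemma measurable_path_stop s : measurable_fun setT (path_stop s).
Proof. by apply: measurable_fun_fspace => t; exact: measurable_eval. Qed.

Lemma measurable_path_shift s : measurable_fun setT (path_shift s).
Proof.
by apply: measurable_fun_fspace => t; apply: measurable_cVB; exact: measurable_eval.
Qed.

Lemma measurable_path_rev s : measurable_fun setT (path_rev s).
Proof.
by apply: measurable_fun_fspace => t; apply: measurable_cVB; exact: measurable_eval.
Qed.

Lemma stop_ofE s x : 0 <= s -> stop_of J s x = path_stop s (path_of J x).
Proof.
move=> s0; apply/funext => t; rewrite /path_stop /path_of tpos_id//.
by case/andP: (tclip_itv t s0).
Qed.

Lemma shift_ofE s x : 0 <= s -> shift_of J s x = path_shift s (path_of J x).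
Proof.
move=> s0; apply/funext => t; rewrite /path_shift /path_of (tpos_id s0).
by rewrite (@tpos_id _ (s + tpos t)) ?addr_ge0 ?tpos_ge0.
Qed.

Lemma rev_ofE s x : 0 <= s -> rev_of J s x = path_rev s (path_of J x).
Proof.
move=> s0; apply/funext => t; rewrite /path_rev /path_of (tpos_id s0).
by rewrite (@tpos_id _ (s - tclip s t)) ?subr_ge0//; case/andP: (tclip_itv t s0).
Qed.

(** The Markov property with a random initial state: [w] is independent of the whole path and the
    past is independent of the future, so on rectangles both sides are products of three
    probabilities. *)
Lemma pair_stop_shift s (C1 : set (E * fspace R E)) (C2 : set (fspace R E)) : 0 <= s ->
  measurable C1 -> measurable C2 ->
  Pr ((fun x => (w x, stop_of J s x)) @^-1` C1 `&` shift_of J s @^-1` C2) =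
  (Pr ((fun x => (w x, stop_of J s x)) @^-1` C1) * Pr (shift_of J s @^-1` C2))%E.
Proof.
move=> s0 mC1 mC2; rewrite [RHS]muleC.
have mst := measurable_stop_of HJ s0; have msh := measurable_shift_of HJ s0.
apply: eq_law_prod => //.
- exact: measurable_preimage.
- by apply: fin_num_measure; exact: measurable_preimage.
move=> A B mA mB.
have stE : stop_of J s @^-1` B = path_of J @^-1` (path_stop s @^-1` B).
  by apply/seteqP; split => x /=; rewrite stop_ofE.
have shE : shift_of J s @^-1` C2 = path_of J @^-1` (path_shift s @^-1` C2).
  by apply/seteqP; split => x /=; rewrite shift_ofE.
have mB' := measurable_preimage (@measurable_path_stop s) mB.
have mC2' := measurable_preimage (@measurable_path_shift s) mC2.
rewrite -setIA stE shE -preimage_setI wJ//; last exact: measurableI.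
rewrite preimage_setI -shE -stE levy_stop_shift//.
rewrite stE (wJ mA mB') muleA muleC//.
Qed.

(** Reversal acts on the path alone, of which [w] is independent, so it preserves joint laws with
    [w] as well. *)
Lemma pair_rev s (C : set (E * fspace R E)) : 0 <= s -> measurable C ->
  Pr ((fun x => (w x, rev_of J s x)) @^-1` C) =
  Pr ((fun x => (w x, stop_of J s x)) @^-1` C).
Proof.
move=> s0 mC.
have mst := measurable_stop_of HJ s0; have mrv := measurable_rev_of HJ s0.
apply: eq_law_prodT => // A B mA mB.
have stE : stop_of J s @^-1` B = path_of J @^-1` (path_stop s @^-1` B).
  by apply/seteqP; split => x /=; rewrite stop_ofE.
have rvE : rev_of J s @^-1` B = path_of J @^-1` (path_rev s @^-1` B).
  by apply/seteqP; split => x /=; rewrite rev_ofE.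
have mB1 := measurable_preimage (@measurable_path_stop s) mB.
have mB2 := measurable_preimage (@measurable_path_rev s) mB.
by rewrite rvE wJ// -rvE levy_rev// stE wJ.
Qed.

End independent_initial_state.

(** * Right-continuous paths with left limits *)

Section one_sided_limits.
Context (R : realType).
Implicit Types (f : R -> R) (t l : R).

Lemma cvg_at_rightP f t l : (f s @[s --> t^'+] --> l) <->
  (forall e, 0 < e -> exists2 d, 0 < d & forall s, t < s < t + d -> `|f s - l| < e).
Proof.
split=> [/cvgrPdist_lt fl e e0|h].
  have /= [d /= d0 hd] := fl _ e0.
  exists d => // s /andP[ts sd]; rewrite distrC; apply: hd => //=.
  by rewrite distrC gtr0_norm ?subr_gt0// ltrBlDl.
apply/cvgrPdist_lt => e e0; have [d d0 hd] := h _ e0.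
exists d => //= s /= sd ts; rewrite distrC; apply: hd; rewrite ts /=.
by move: sd; rewrite distrC gtr0_norm ?subr_gt0// ltrBlDl.
Qed.

Lemma cvg_at_leftP f t l : (f s @[s --> t^'-] --> l) <->
  (forall e, 0 < e -> exists2 d, 0 < d & forall s, t - d < s < t -> `|f s - l| < e).
Proof.
split=> [/cvgrPdist_lt fl e e0|h].
  have /= [d /= d0 hd] := fl _ e0.
  exists d => // s /andP[ts sd]; rewrite distrC; apply: hd => //=.
  by rewrite gtr0_norm ?subr_gt0// ltrBlDr -ltrBlDl.
apply/cvgrPdist_lt => e e0; have [d d0 hd] := h _ e0.
exists d => //= s /= sd ts; rewrite distrC; apply: hd; rewrite ts andbT.
by move: sd; rewrite gtr0_norm ?subr_gt0// ltrBlDr -ltrBlDl.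
Qed.

Definition rcont f := forall t, 0 <= t -> forall e, 0 < e ->
  exists2 d, 0 < d & forall s, t < s < t + d -> `|f s - f t| < e.

Definition llim f := forall t, 0 < t -> exists l, forall e, 0 < e ->
  exists2 d, 0 < d & forall s, t - d < s < t -> `|f s - l| < e.

Lemma rcontD f g : rcont f -> rcont g -> rcont (fun t => f t + g t).
Proof.
move=> hf hg t t0 e e0; have e2 : 0 < e / 2 by rewrite divr_gt0.
have [d1 d10 h1] := hf t t0 _ e2; have [d2 d20 h2] := hg t t0 _ e2.
exists (Num.min d1 d2); first by rewrite lt_min d10.
move=> s /andP[ts sd].
have s1 : s < t + d1 by apply: (lt_le_trans sd); rewrite lerD2l ge_min lexx.
have s2 : s < t + d2 by apply: (lt_le_trans sd); rewrite lerD2l ge_min lexx orbT.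
have := h1 s; have := h2 s; rewrite ts s1 s2 => /(_ erefl) ? /(_ erefl) ?.
rewrite opprD addrACA; apply: (le_lt_trans (ler_normD _ _)); lra.
Qed.

Lemma rcontZ a f : rcont f -> rcont (fun t => a * f t).
Proof.
move=> hf t t0 e e0; have a0 : 0 < `|a| + 1 by rewrite ltr_wpDl.
have [d d0 h] := hf t t0 (e / (`|a| + 1)) (divr_gt0 e0 a0).
exists d => // s /h; rewrite -mulrBr normrM => hs.
rewrite (le_lt_trans (ler_wpM2r _ (_ : `|a| <= `|a| + 1)))// ?lerDl//.
by rewrite mulrC -ltr_pdivlMr.
Qed.

Lemma rcont_cst a : rcont (fun=> a).
Proof. by move=> t t0 e e0; exists 1 => // s _; rewrite subrr normr0. Qed.

Lemma rcont_sum n (F : 'I_n -> R -> R) : (forall i, rcont (F i)) ->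
  rcont (fun t => \sum_(i < n) F i t).
Proof.
move=> h; elim: n F h => [|n ih] F h.
  rewrite (_ : (fun t => _) = fun=> 0); first exact: rcont_cst.
  by apply/funext => t; rewrite big_ord0.
rewrite (_ : (fun t => _) = fun t => \sum_(i < n) F (widen_ord (leqnSn n) i) t + F ord_max t).
  by apply: rcontD => //; exact: ih.
by apply/funext => t; rewrite big_ord_recr.
Qed.

Lemma rcont_id : rcont id.
Proof.
move=> t t0 e e0; exists e => // s /andP[ts sd] /=.
by rewrite gtr0_norm ?subr_gt0// ltrBlDl.
Qed.

Lemma llimD f g : llim f -> llim g -> llim (fun t => f t + g t).
Proof.
move=> hf hg t t0; have [l hl] := hf _ t0; have [m hm] := hg _ t0.
exists (l + m) => e e0; have e2 : 0 < e / 2 by rewrite divr_gt0.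
have [d1 d10 h1] := hl _ e2; have [d2 d20 h2] := hm _ e2.
exists (Num.min d1 d2); first by rewrite lt_min d10.
move=> s /andP[ts sd].
have s1 : t - d1 < s.
  by apply: le_lt_trans ts; rewrite lerD2l lerN2 ge_min lexx.
have s2 : t - d2 < s.
  by apply: le_lt_trans ts; rewrite lerD2l lerN2 ge_min lexx orbT.
have := h1 s; have := h2 s; rewrite sd s1 s2 => /(_ erefl) ? /(_ erefl) ?.
rewrite opprD addrACA; apply: (le_lt_trans (ler_normD _ _)); lra.
Qed.

Lemma llimZ a f : llim f -> llim (fun t => a * f t).
Proof.
move=> hf t t0; have [l hl] := hf _ t0; exists (a * l) => e e0.
have a0 : 0 < `|a| + 1 by rewrite ltr_wpDl.
have [d d0 h] := hl (e / (`|a| + 1)) (divr_gt0 e0 a0).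
exists d => // s /h; rewrite -mulrBr normrM => hs.
rewrite (le_lt_trans (ler_wpM2r _ (_ : `|a| <= `|a| + 1)))// ?lerDl//.
by rewrite mulrC -ltr_pdivlMr.
Qed.

Lemma llim_cst a : llim (fun=> a).
Proof. by move=> t t0; exists a => e e0; exists 1 => // s _; rewrite subrr normr0. Qed.

Lemma llim_id : llim id.
Proof.
move=> t t0; exists t => e e0; exists e => // s /andP[ts sd] /=.
by rewrite distrC gtr0_norm ?subr_gt0// ltrBlDl -ltrBlDr.
Qed.

Lemma llim_sum n (F : 'I_n -> R -> R) : (forall i, llim (F i)) ->
  llim (fun t => \sum_(i < n) F i t).
Proof.
move=> h; elim: n F h => [|n ih] F h.
  rewrite (_ : (fun t => _) = fun=> 0); first exact: llim_cst.
  by apply/funext => t; rewrite big_ord0.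
rewrite (_ : (fun t => _) = fun t => \sum_(i < n) F (widen_ord (leqnSn n) i) t + F ord_max t).
  by apply: llimD => //; exact: ih.
by apply/funext => t; rewrite big_ord_recr.
Qed.

(** Induction along the real line: at the supremum of the times up to which [f] is bounded, the left
    limit controls [f] just before and right continuity just after, so the bound extends further
    unless [b] is reached. *)
Lemma rcll_bounded f b : rcont f -> llim f -> 0 <= b ->
  exists M, forall t, 0 <= t <= b -> f t <= M.
Proof.
move=> rf lf b0.
pose S := [set t | 0 <= t <= b /\ exists M, forall u, 0 <= u <= t -> f u <= M].
have S0 : S 0.
  split; first by rewrite lexx.
  by exists (f 0) => u /andP[? ?]; rewrite (_ : u = 0)//; apply/eqP; rewrite eq_le; apply/andP.
have hS : has_sup S.
  by split; [exists 0|exists b => t [/andP[]]].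
have s0 : 0 <= sup S by apply: ub_le_sup => //; case: hS.
have sb : sup S <= b by apply: ge_sup; [exists 0|move=> t [/andP[]]].
have [M hM] : exists M, forall u, 0 <= u < sup S -> f u <= M.
  have [s00|s00] := eqVneq (sup S) 0.
    by exists 0 => u; rewrite s00 => /andP[u0 /(le_lt_trans u0)]; rewrite ltxx.
  have sp : 0 < sup S by rewrite lt_def s00.
  have [l hl] := lf _ sp; have [d d0 hd] := hl 1 ltr01.
  have [t St tlt] := sup_adherent d0 hS.
  have [_ [M hM]] := St.
  exists (Num.max M (l + 1)) => u /andP[u0 us].
  rewrite le_max; have [ut|tu] := leP u t; first by rewrite hM ?u0.
  have := hd u; rewrite us (lt_trans tlt tu) => /(_ erefl).
  by rewrite ltr_norml => /andP[_ h]; apply/orP; right; rewrite addrC -lerBlDr ltW.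
have [d d0 hd] := rf _ s0 1 ltr01.
pose M' := Num.max M (f (sup S) + 1).
have hM' u : 0 <= u < sup S + d -> f u <= M'.
  move=> /andP[u0 ud]; rewrite /M' le_max.
  have [us|us|->] := ltgtP u (sup S).
  - by rewrite hM// u0.
  - have := hd u; rewrite us ud => /(_ erefl).
    by rewrite ltr_norml => /andP[_ h]; apply/orP; right; rewrite addrC -lerBlDr ltW.
  - by rewrite lerDl ler01 orbT.
have [sb'|sb'] := ltP b (sup S + d / 2).
  exists M' => t /andP[t0 tb]; apply: hM'; rewrite t0 /=; lra.
suff : sup S + d / 2 <= sup S by lra.
apply: ub_le_sup; first by case: hS.
split; first by rewrite sb' andbT; lra.
exists M' => u /andP[u0 us]; apply: hM'; rewrite u0 /=; lra.
Qed.

(** Each point below [b] is approached from its right by points of [S]. The end [b] has no such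
    approximation inside the interval, so it is asked to belong to [S]. *)
Lemma rcont_le_dense f b c (S : set R) : rcont f ->
  (forall u, S u -> f u <= c) -> S b ->
  (forall u e, 0 <= u < b -> 0 < e -> exists2 v, u < v < u + e & S v) ->
  forall u, 0 <= u <= b -> f u <= c.
Proof.
move=> rf fS Sb dS u /andP[u0]; rewrite le_eqVlt => /predU1P[->|ub]; first exact: fS.
rewrite leNgt; apply/negP => cf.
have cf' : 0 < f u - c by rewrite subr_gt0.
have [d d0 hd] := rf u u0 _ cf'.
have ub' : 0 <= u < b by rewrite u0.
have [v uv Sv] := dS u d ub' d0.
have := hd v uv; rewrite ltr_norml => /andP[h _].
by have := fS v Sv; lra.
Qed.

End one_sided_limits.

Section dyadics.
Context (R : realType).

(* An enumeration of the nonnegative dyadic numbers. *)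
Definition dyad (m : nat) : R :=
  let: (i, k) := odflt (0%N, 0%N) (unpickle m) in i%:R / 2 ^+ k.

Lemma dyad_ge0 m : 0 <= dyad m.
Proof. by rewrite /dyad; case: (odflt _ _) => i k; rewrite divr_ge0. Qed.

Lemma dyadE i k : exists m, dyad m = i%:R / 2 ^+ k.
Proof. by exists (pickle (i, k)); rewrite /dyad pickleK. Qed.

Lemma dyadic_above (u e : R) : 0 <= u -> 0 < e ->
  exists k, forall k', (k <= k')%N -> exists i, u < i%:R / 2 ^+ k' < u + e.
Proof.
move=> u0 e0.
have [k hk] : exists k : nat, e^-1 < 2 ^+ k.
  exists (Num.truncn e^-1).+1; apply: lt_le_trans (_ : (Num.truncn e^-1).+1%:R <= _).
    by rewrite truncnS_gt.
  by rewrite -natrX ler_nat ltnW// ltn_expl.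
exists k => k' kk'; exists (Num.truncn (u * 2 ^+ k')).+1.
have p0 : 0 < 2 ^+ k' :> R by rewrite exprn_gt0.
rewrite ltr_pdivlMr// truncnS_gt /= ltr_pdivrMr// mulrDl -natr1 ler_ltD//.
  by rewrite truncn_le mulr_ge0// ltW.
rewrite mulrC -ltr_pdivrMr// mul1r (lt_le_trans hk)//.
by rewrite ler_eXn2l ?ltr1n.
Qed.

Lemma dyad_dense (u e : R) : 0 <= u -> 0 < e -> exists m, u < dyad m < u + e.
Proof.
move=> u0 e0; have [k /(_ k (leqnn _))[i hi]] := dyadic_above u0 e0.
by have [m hm] := dyadE i k; exists m; rewrite hm.
Qed.

Lemma dyad0 : exists m, dyad m = 0.
Proof. by have [m hm] := dyadE 0 0; exists m; rewrite hm mul0r. Qed.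

End dyadics.

(** * Stieltjes integrals and the one-dimensional regulator *)

Section integral_null.
Import HBNNSimple.
Local Open Scope ereal_scope.
Context d (T : measurableType d) (R : realType) (mu : {measure set T -> \bar R}).

(* Both lemmas avoid measurability of [f]: the integral of a nonnegative
   function is a supremum over the simple functions below it. *)
Lemma integral0_null (f : T -> \bar R) (D B : set T) (e : R) :
  (forall x, D x -> 0 <= f x) -> measurable B -> B `<=` D -> (0 < e)%R ->
  (forall x, B x -> e%:E <= f x) -> \int[mu]_(x in D) f x = 0 -> mu B = 0.
Proof.
move=> f0 mB BD e0 ef; rewrite ge0_integralE//; set I := ereal_sup _ => int0.
have e0' : (0 <= e)%R by exact: ltW.
pose g := scale_nnsfun (indic_nnsfun R mB) e0'.
have : sintegral mu g <= 0.
  rewrite -[leRHS]int0 /I; apply: ereal_sup_ubound; exists g => // x.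
  rewrite /g /= /patch mindicE.
  have [xB|xB] := boolP (x \in B).
    rewrite inE in xB; rewrite mulr1 ifT; first exact: ef.
    by rewrite inE; exact: BD.
  rewrite mulr0; case: ifPn => //; rewrite inE => ?; exact: f0.
rewrite /g sintegralrM sintegral_indic => h.
apply/eqP; rewrite -measure_le0.
by rewrite -(@pmule_rle0 _ e%:E) ?lte_fin//.
Qed.

Lemma null_integral0 (f : T -> \bar R) (D : set T) :
  (forall x, D x -> 0 <= f x) -> mu.-negligible [set x | D x /\ 0 < f x] ->
  \int[mu]_(x in D) f x = 0.
Proof.
move=> f0 [N [mN muN fN]]; rewrite ge0_integralE//.
apply/eqP; rewrite eq_le; apply/andP; split; last first.
  apply: ereal_sup_ubound; exists nnsfun0; last exact: sintegral0.
  by move=> x; rewrite /patch; case: ifPn => //; rewrite inE => ?; exact: f0.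
apply: ge_ereal_sup => _ [h hf <-].
rewrite sintegralE fsbig1// => r [x _ <-].
have [h0|h0] := eqVneq (h x) 0%R; first by rewrite h0 mul0e.
suff -> : mu (h @^-1` [set h x]) = 0 by rewrite mule0.
have hN : h @^-1` [set h x] `<=` N.
  move=> y /= hyx; apply: fN.
  have hy0 : (0 < h y)%R by rewrite lt_def hyx h0 -hyx fun_ge0.
  have := hf y; rewrite /patch; case: ifPn => [/set_mem Dy hle|_].
    by split => //; apply: lt_le_trans hle; rewrite lte_fin.
  by rewrite lee_fin leNgt hy0.
apply/eqP; rewrite -measure_le0 -muN le_measure// ?inE//.
Qed.

Lemma measure_bigcap_ge (F : (set T)^nat) (c : \bar R) : mu (F 0%N) < +oo ->
  (forall i, measurable (F i)) -> nonincreasing_seq F -> (forall i, c <= mu (F i)) ->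
  c <= mu (\bigcap_i F i).
Proof.
move=> F0 mF ni h.
have mI : measurable (\bigcap_i F i) by exact: bigcapT_measurable.
have cv := nonincreasing_cvg_mu F0 mF mI ni.
rewrite -(cvg_lim _ cv)//; apply: lime_ge; first by apply/cvg_ex; eexists; exact: cv.
by apply: nearW => n; exact: h.
Qed.

End integral_null.

Section stieltjes.
Context (R : realType) (F : cumulative R R).
Local Notation mu := (lebesgue_stieltjes_measure F).

Lemma stieltjes_itvoc (a b : R) : a <= b -> mu `]a, b]%classic = (F b - F a)%:E.
Proof.
move=> ab; rewrite /lebesgue_stieltjes_measure/= /measure_extension/=.
rewrite measurable_mu_extE/=; last exact: is_ocitv.
by rewrite wlength_itv_bnd.
Qed.

Lemma stieltjes_negligible (A : set R) :
  (forall e, 0 < e -> exists a b, [/\ a <= b, A `<=` `]a, b]%classic & F b - F a <= e]) ->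
  mu.-negligible A.
Proof.
move=> h.
have h' (k : nat) : exists ab : R * R, [/\ ab.1 <= ab.2,
    A `<=` `]ab.1, ab.2]%classic & F ab.2 - F ab.1 <= k.+1%:R^-1].
  by have [//|a [b ?]] := h k.+1%:R^-1; exists (a, b).
have [g hg] := choice h'.
exists (\bigcap_k `](g k).1, (g k).2]%classic); split.
- by apply: bigcapT_measurable => k; exact: measurable_itv.
- apply/eqP; rewrite -measure_le0; apply/lee_addgt0Pr => e e0; rewrite add0e.
  pose k := Num.truncn e^-1.
  have [ab _ Fk] := hg k.
  apply: (@le_trans _ _ (mu `](g k).1, (g k).2]%classic)).
    apply: le_measure; rewrite ?inE; first by apply: bigcapT_measurable => ?; exact: measurable_itv.
      exact: measurable_itv.
    by move=> x; apply.
  rewrite stieltjes_itvoc// lee_fin (le_trans Fk)// invf_ple ?posrE//.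
  by rewrite ltW// truncnS_gt.
- by move=> x Ax k _; have [_ + _] := hg k; apply.
Qed.

(* [l] cannot exceed [M]: on the set where [l >= M + e] the integrand is at
   least [e], so [l] would not increase there. *)
Lemma complementarity_le (l f : R -> R) (t0 M : R) :
  (forall t, F t = l (Num.max t 0)) -> l 0 = 0 -> rcont l ->
  (forall s t, 0 <= s -> s <= t -> l s <= l t) ->
  (forall t, 0 <= t -> 0 <= f t) ->
  (\int[mu]_(t in `[0%R, +oo[) (f t)%:E = 0)%E ->
  0 <= t0 -> 0 <= M -> (forall u, 0 <= u <= t0 -> l u - M <= f u) ->
  l t0 <= M.
Proof.
move=> Fl l0 rl ndl f0 int0 t00 M0 lMf; rewrite leNgt; apply/negP => Mlt.
(* Half the excess, so that [l t0 = M + 2 * e]. As [l < M + e] before the first time [tau] at level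
   [M + e], the closed interval from [tau] to [t0] has mass at least [e], a jump at [tau]
   included. *)
pose e := (l t0 - M) / 2.
have e0 : 0 < e by rewrite divr_gt0// subr_gt0.
pose S := [set u | 0 <= u <= t0 /\ M + e <= l u].
have St0 : S t0 by split; [rewrite t00 lexx|rewrite /e; lra].
have infS : has_inf S by split; [exists t0|exists 0 => u [/andP[]]].
pose tau := inf S.
have tau0 : 0 <= tau by apply: lb_le_inf; [exists t0|move=> u [/andP[]]].
have taut0 : tau <= t0 by apply: ge_inf => //; case: infS.
have ltau : M + e <= l tau.
  apply/ler_addgt0Pr => a a0; have [d d0 hd] := rl tau tau0 a a0.
  have [u [/andP[u0 ut] lu] utau] := inf_adherent d0 infS.
  have tu : tau <= u.
    by apply: ge_inf; [case: infS|split => //; rewrite u0].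
  move: tu; rewrite le_eqVlt => /predU1P[->|tu]; first by rewrite (le_trans lu)// lerDl ltW.
  have := hd u; rewrite tu utau => /(_ erefl); rewrite ltr_norml => /andP[_ ?]; lra.
pose B := `[tau, t0]%classic.
have muB : mu B = 0%E.
  apply: (@integral0_null _ _ _ mu (fun t => (f t)%:E) `[0%R, +oo[ B e) => //.
  - by move=> x; rewrite /= in_itv/= andbT lee_fin => ?; exact: f0.
  - exact: measurable_itv.
  - move=> x; rewrite /B /= !in_itv/= andbT => /andP[? _]; exact: le_trans tau0 _.
  - move=> x; rewrite /B /= in_itv/= lee_fin => /andP[tx xt].
    have x0 : 0 <= x by exact: le_trans tx.
    apply: le_trans (lMf x _); last by rewrite x0.
    by have := ndl _ _ tau0 tx; lra.
suff : (e%:E <= mu B)%E by rewrite muB lee_fin leNgt e0.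
(* The mass is computed on left-open intervals; their intersection recovers the closed one with its
   possible atom at [tau]. *)
rewrite (_ : B = \bigcap_k `](tau - k.+1%:R^-1), t0]%classic); last first.
  apply/seteqP; split => x.
    rewrite /B /= in_itv/= => /andP[tx xt] k _; rewrite /= in_itv/= xt andbT.
    by rewrite (lt_le_trans _ tx)// ltrBlDr ltrDl.
  move=> h; rewrite /B /= in_itv/=; apply/andP; split; last first.
    by have := h 0%N Logic.I; rewrite /= in_itv/= => /andP[].
  apply/ler_addgt0Pr => a a0.
  have := h (Num.truncn a^-1) Logic.I; rewrite /= in_itv/= => /andP[+ _].
  have : (Num.truncn a^-1).+1%:R^-1 <= a.
    by rewrite invf_ple ?posrE// ltW// truncnS_gt.
  by move: (_.+1%:R^-1) => b; lra.
have tk (k : nat) : tau - k.+1%:R^-1 <= t0.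
  by rewrite (le_trans _ taut0)// gerBl.
pose G (k : nat) := `](tau - k.+1%:R^-1), t0]%classic.
have muG k : mu (G k) = (F t0 - F (tau - k.+1%:R^-1))%:E by exact: stieltjes_itvoc.
have niG : nonincreasing_seq G.
  move=> i j ij; apply/subsetPset => x; rewrite /G /= !in_itv/= => /andP[h ->].
  rewrite andbT (le_lt_trans _ h)// lerD2l lerN2 lef_pV2 ?posrE//.
  by rewrite ler_nat ltnS.
have mu0 : (mu (G 0%N) < +oo)%E by rewrite muG ltry.
have mG k : measurable (G k) by exact: measurable_itv.
apply: (measure_bigcap_ge mu0 mG niG) => k.
have : (e%:E <= mu (G k))%E; last exact.
rewrite muG lee_fin !Fl (max_idPl t00).
have [tk0|tk0] := leP (tau - k.+1%:R^-1) 0; first by rewrite l0 /e; lra.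
suff : l (tau - k.+1%:R^-1) < M + e by rewrite /e; lra.
rewrite ltNge; apply/negP => h.
suff : tau <= tau - k.+1%:R^-1 by rewrite leNgt gtrBl invr_gt0 ltr0n.
by apply: ge_inf; [case: infS|split => //; rewrite tk andbT ltW].
Qed.

End stieltjes.

Section regulator.
Context (R : realType).

(** For the regulator of one-dimensional reflection at 0. The point 0 keeps the set inhabited at
    negative times and the supremum nonnegative. *)
Definition regset (z : R -> R) (t : R) : set R :=
  [set 0] `|` [set - z u | u in [set u | 0 <= u <= t]].
Definition reg (z : R -> R) (t : R) : R := sup (regset z t).

Variable z : R -> R.
Hypotheses (rz : rcont z) (lz : llim z).

Lemma has_sup_regset t : has_sup (regset z t).
Proof.
split; first by exists 0; left.
have [t0|t0] := leP 0 t; last first.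
  exists 0 => x [->//|[u /andP[u0 ut] _]].
  by have := le_lt_trans (le_trans u0 ut) t0; rewrite ltxx.
have [M hM] : exists M, forall u, 0 <= u <= t -> - z u <= M.
  have := @rcll_bounded _ (fun u => -1 * z u) t (rcontZ _ rz) (llimZ _ lz) t0.
  by move=> [M hM]; exists M => u /hM; rewrite mulN1r.
exists (Num.max 0 M) => x [->|[u ut <-]]; first by rewrite le_max lexx.
by rewrite le_max hM ?orbT.
Qed.

Lemma reg_ge0 t : 0 <= reg z t.
Proof. by apply: ub_le_sup; [case: (has_sup_regset t)|left]. Qed.

Lemma reg_ub u t : 0 <= u <= t -> - z u <= reg z t.
Proof. by move=> ut; apply: ub_le_sup; [case: (has_sup_regset t)|right; exists u]. Qed.

Lemma reg_le t c : 0 <= c -> (forall u, 0 <= u <= t -> - z u <= c) -> reg z t <= c.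
Proof.
move=> c0 h; apply: ge_sup; first by case: (has_sup_regset t).
by move=> x [->//|[u ut <-]]; exact: h.
Qed.

Lemma reg_nd s t : s <= t -> reg z s <= reg z t.
Proof.
move=> st; apply: reg_le; first exact: reg_ge0.
by move=> u /andP[u0 us]; apply: reg_ub; rewrite u0 (le_trans us).
Qed.

Lemma reg0 : 0 <= z 0 -> reg z 0 = 0.
Proof.
move=> z0; apply/eqP; rewrite eq_le reg_ge0 andbT; apply: reg_le => // u.
by rewrite -eq_le => /eqP <-; rewrite oppr_le0.
Qed.

Lemma rcont_reg : rcont (reg z).
Proof.
move=> t t0 e e0; have e2 : 0 < e / 2 by rewrite divr_gt0.
have [d d0 hd] := rz t0 e2; exists d => // s /andP[ts sd].
rewrite ger0_norm ?subr_ge0; last exact: reg_nd (ltW ts).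
suff : reg z s <= reg z t + e / 2 by lra.
apply: reg_le => [|u /andP[u0 us]]; first by rewrite addr_ge0// ?reg_ge0// ltW.
have [ut|tu] := leP u t; first by rewrite (le_trans (reg_ub _ : _ <= reg z t)) ?u0// lerDl ltW.
have := hd u; rewrite tu (le_lt_trans us sd) => /(_ erefl).
have : - z t <= reg z t by apply: reg_ub; rewrite t0 lexx.
by rewrite ltr_norml => ? /andP[? ?]; lra.
Qed.

Lemma nondecreasing_llim (l : R -> R) :
  (forall s t, 0 <= s -> s <= t -> l s <= l t) -> llim l.
Proof.
move=> nd t t0; pose S := [set l s | s in [set s | 0 <= s < t]].
have hS : has_sup S.
  split; first by exists (l 0), 0 => //=; rewrite lexx t0.
  by exists (l t) => _ [s /andP[s0 st] <-]; apply: nd => //; exact: ltW.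
exists (sup S) => e e0; have [_ [s /andP[s0 st] <-] hs] := sup_adherent e0 hS.
exists (t - s); first by rewrite subr_gt0.
move=> u; rewrite subKr => /andP[su ut].
have : l s <= l u by apply: nd => //; exact: ltW.
have : l u <= sup S.
  by apply: ub_le_sup; [case: hS|exists u => //=; rewrite ut (le_trans s0)// ltW].
by rewrite ltr_norml => ? ?; apply/andP; split; lra.
Qed.

Lemma llim_reg : llim (reg z).
Proof. by apply: nondecreasing_llim => s t _; exact: reg_nd. Qed.

(** Where [z + reg z] is positive, right continuity keeps [reg z] constant up to some dyadic time
    [q]. Such points lie in countably many sets [C q], each null because [reg z] takes a single
    value on it and does not jump at its points. The integrand [f] will be W_j and [z + reg z] will
    be V_j, whence the mere implication between their positivity. *)
Lemma reg_complementary (F : cumulative R R) (f : R -> R) :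
  (forall t, F t = reg z (Num.max t 0)) ->
  (forall t, 0 <= t -> 0 <= f t) ->
  (forall t, 0 <= t -> 0 < f t -> 0 < z t + reg z t) ->
  (\int[lebesgue_stieltjes_measure F]_(t in `[0%R, +oo[) (f t)%:E = 0)%E.
Proof.
move=> FE f0 fz.
have Fmon := cumulative_is_nondecreasing F.
(* A jump of [reg z] at [u] would make [- z u] the new supremum, against [0 < z u + reg z u]. *)
have no_atom u e : 0 <= u -> 0 < z u + reg z u -> 0 < e ->
    exists2 s, s < u & F u - F s <= e.
  move=> u0 zu e0; rewrite FE (max_idPl u0).
  have [->|u00] := eqVneq u 0.
    (* At [u = 0] the extension to negative times makes [F] constant to the left. *)
    by exists (-1); rewrite ?ltrN10// FE (max_idPr _) ?lerN10// subrr ltW.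
  have up : 0 < u by rewrite lt_def u00.
  have [r0|r0] := eqVneq (reg z u) 0.
    exists 0 => //; rewrite r0 FE maxxx sub0r (le_trans _ (ltW e0))//.
    by rewrite oppr_le0 reg_ge0.
  have rp : 0 < reg z u by rewrite lt_def r0 reg_ge0.
  (* An element of [regset z u] this close to the supremum is not the point 0, because of the bound
     [reg z u], and does not come from [u], because of the bound [reg z u + z u]; so it comes from
     some [s < u]. *)
  have e'0 : 0 < Num.min e (Num.min (reg z u + z u) (reg z u)).
    by rewrite !lt_min e0 rp andbT addrC.
  have [_ [->|[s /andP[s0 su] <-]] hs] := sup_adherent e'0 (has_sup_regset u).
    have : Num.min e (Num.min (reg z u + z u) (reg z u)) <= reg z u.
      by rewrite ge_min orbC ge_min lexx orbT.
    by rewrite -/(reg z u) in hs; move=> ?; lra.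
  rewrite -/(reg z u) in hs.
  have m1 : Num.min e (Num.min (reg z u + z u) (reg z u)) <= e by rewrite ge_min lexx.
  have m2 : Num.min e (Num.min (reg z u + z u) (reg z u)) <= reg z u + z u.
    by rewrite ge_min orbC ge_min lexx.
  exists s.
    rewrite lt_neqAle su andbT; apply/eqP => E; move: hs; rewrite E; lra.
  have : - z s <= reg z s by apply: reg_ub; rewrite s0 lexx.
  by rewrite FE (max_idPl s0); lra.
pose C q := [set u | [/\ 0 <= u <= q, reg z u = reg z q & 0 < z u + reg z u]].
have Cneg m : (lebesgue_stieltjes_measure F).-negligible (C (dyad R m)).
  set q := dyad R m; have q0 : 0 <= q by exact: dyad_ge0.
  apply: stieltjes_negligible => e e0.
  have [C0|/set0P[u0 Cu0]] := eqVneq (C q) set0.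
    by exists q, q; split => //; rewrite ?C0// subrr ltW.
  have hC : has_inf (C q) by split; [exists u0|exists 0 => u [/andP[]]].
  have i0 : 0 <= inf (C q) by apply: lb_le_inf; [exists u0|move=> u [/andP[]]].
  have iq : inf (C q) <= q.
    have [/andP[_ h] _ _] := Cu0; apply: le_trans h; apply: ge_inf => //.
    by case: hC.
  have Fq : F q = reg z q by rewrite FE (max_idPl q0).
  have Ci u : C q u -> inf (C q) <= u by move=> Cu; apply: ge_inf => //; case: hC.
  (* A covering interval is open on the left. If the infimum belongs to [C q], the interval has to
     start strictly before it, which [no_atom] makes cheap; otherwise it may start there, by right
     continuity. *)
  have [Cinf|Cinf] := pselect (C q (inf (C q))).
    have [_ rE zi] := Cinf.
    have [s si Fs] := no_atom _ _ i0 zi e0.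
    exists s, q; split.
    - by rewrite (le_trans (ltW si)).
    - move=> u Cu; rewrite /= in_itv/= (lt_le_trans si (Ci _ Cu)) /=.
      by have [/andP[]] := Cu.
    - by move: Fs; rewrite Fq FE (max_idPl i0) rE.
  exists (inf (C q)), q; split => //.
    move=> u Cu; rewrite /= in_itv/= lt_neqAle Ci// andbT.
    have [/andP[_ ->] _ _] := Cu; rewrite andbT.
    by apply/eqP => E; apply: Cinf; rewrite E.
  have [d d0 hd] := rcont_reg i0 e0.
  have [u Cu ui] := inf_adherent d0 hC.
  have iu : inf (C q) < u.
    rewrite lt_neqAle Ci// andbT; apply/eqP => E; apply: Cinf.
    by rewrite E.
  have := hd u; rewrite iu ui => /(_ erefl); have [_ -> _] := Cu.
  by rewrite Fq FE (max_idPl i0) ltr_norml => /andP[_ /ltW].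
apply: null_integral0 => [t|]; first by rewrite /= in_itv/= andbT lee_fin => ?; exact: f0.
apply: negligibleS (negligible_bigcup Cneg).
move=> u [/=]; rewrite in_itv/= andbT lte_fin => u0 /(fz u u0) zu.
have [d d0 hd] := rz u0 zu.
have [m /andP[um md]] := dyad_dense u0 d0.
exists m => //; split => //; first by rewrite u0 ltW.
apply/eqP; rewrite eq_le; apply/andP; split; first exact: reg_nd (ltW um).
apply: reg_le => [|s /andP[s0 sm]]; first exact: reg_ge0.
have [su|us] := leP s u; first by apply: reg_ub; rewrite s0.
have := hd s; rewrite us (le_lt_trans sm md) => /(_ erefl).
by rewrite ltr_norml => /andP[? _]; lra.
Qed.

End regulator.

(** * The Skorokhod problem of a tree network *)

(** Equalities between maxima and suprema are proved through their upper bounds, which turns them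
    into equivalences of universally quantified inequalities. *)
Lemma eq_le_bounds (R : realType) (a b : R) : (forall c, (a <= c) <-> (b <= c)) -> a = b.
Proof. by move=> h; apply/eqP; rewrite eq_le; apply/andP; split; apply/h. Qed.

Section tree.
Context (R : realType) (n : nat) (r : 'cV[R]_n) (P : 'M[R]_n).
Hypothesis Htree : tree_network r P.
Hypothesis T1 : forall i j, 0 < P i j -> r j ord0 / r i ord0 < P i j.
Local Notation E := 'cV[R]_n.
Local Notation IP := (1%:M - P^T).
Local Notation Q := (invmx IP).

(** Routing only goes upward in index, so the matrix is triangular with ones on the diagonal. *)
Lemma tree_unitmx : IP \in unitmx.
Proof.
rewrite unitmxE det_trig.
  rewrite big1 ?unitr1// => i _.
  by rewrite !mxE eqxx (tree_routing_diag Htree) subr0.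
apply/is_trig_mxP => i j ij; rewrite !mxE (tree_routing_upper Htree)// subr0.
by case: eqP => // E; rewrite E ltnn in ij.
Qed.

Lemma mulQ (v : E) : IP *m (Q *m v) = v.
Proof. by rewrite mulmxA mulmxV ?mul1mx// tree_unitmx. Qed.

Lemma mulIP (v : E) : Q *m (IP *m v) = v.
Proof. by rewrite mulmxA mulVmx ?mul1mx// tree_unitmx. Qed.

Lemma IPE (v : E) j : (IP *m v) j ord0 = v j ord0 - \sum_i P i j * v i ord0.
Proof.
rewrite mulmxBl mul1mx !mxE; congr (_ - _).
by apply: eq_bigr => i _; rewrite mxE.
Qed.

(** The column of the root vanishes and every other column has a single positive entry, so a sum
    over a column has at most one term. (T1) enters here, multiplied out. *)
Lemma tree_parent (j : 'I_n) : (forall v : 'I_n -> R, \sum_i P i j * v i = 0) \/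
  exists i : 'I_n, [/\ (i < j)%N, 0 < P i j, r j ord0 < P i j * r i ord0 &
    forall v : 'I_n -> R, \sum_k P k j * v k = P i j * v i].
Proof.
have [j0|j0] := posnP j.
  left=> v; rewrite big1// => i _.
  have [ij|ij] := ltnP j i; first by rewrite (tree_routing_upper Htree)// mul0r.
  have -> : i = j by apply: ord_inj; apply/eqP; rewrite eqn_leq ij j0.
  by rewrite (tree_routing_diag Htree) mul0r.
right; have [i [Pij uni]] := tree_routing_parent Htree j0.
exists i; split => //.
- rewrite ltnNge leq_eqVlt; apply/negP => /orP[/eqP E|ji].
    by move: Pij; rewrite (ord_inj E) (tree_routing_diag Htree) ltxx.
  by move: Pij; rewrite (tree_routing_upper Htree)// ltxx.
- by rewrite -ltr_pdivrMr ?T1// (tree_rate_gt0 Htree).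
- move=> v; rewrite (bigD1 i)//= big1 ?addr0// => k ki.
  suff -> : P k j = 0 by rewrite mul0r.
  apply/eqP; rewrite eq_le (tree_routing_ge0 Htree) andbT leNgt.
  by apply/negP => /uni E; rewrite E eqxx in ki.
Qed.

Lemma Q_recur (v : E) j :
  (Q *m v) j ord0 = v j ord0 + \sum_i P i j * (Q *m v) i ord0.
Proof. by rewrite -{2}(mulQ v) IPE subrK. Qed.

Lemma tree_ind (K : 'I_n -> Prop) :
  (forall j : 'I_n, (forall i : 'I_n, (i < j)%N -> K i) -> K j) -> forall j, K j.
Proof.
move=> h j; have [m jm] : exists m, (j < m)%N by exists n.
elim: m j jm => // m ih j jm.
by apply: h => i ij; apply: ih; exact: leq_trans ij _.
Qed.

Lemma Q_ge0 (w : E) : (forall j, 0 <= w j ord0) -> forall j, 0 <= (Q *m w) j ord0.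
Proof.
move=> w0; apply: tree_ind => j ih; rewrite Q_recur addr_ge0//.
have [h|[i [ij p0 _ h]]] := tree_parent j; first by rewrite (h (fun i => (Q *m w) i ord0)).
by rewrite (h (fun i => (Q *m w) i ord0)) mulr_ge0 ?ih// ltW.
Qed.

Definition free (p : R -> E) (t : R) : E := Q *m p t - t *: r.

Definition input_path (p : R -> E) : Prop :=
  [/\ cadlag p, p 0 = 0 & forall j : 'I_n, (0 < j)%N ->
      forall s t : R, 0 <= s -> s <= t -> p s j ord0 <= p t j ord0].

Section path.
Variable p : R -> E.
Hypothesis Hp : input_path p.

Lemma freeE t j : free p t j ord0 = \sum_i Q j i * p t i ord0 + (- r j ord0) * t.
Proof. by rewrite /free !mxE mulNr mulrC. Qed.

Lemma freeQ t j : free p t j ord0 = (Q *m p t) j ord0 - t * r j ord0.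
Proof. by rewrite /free [LHS]mxE; congr (_ + _); rewrite !mxE. Qed.

Lemma rcont_input i : rcont (fun t => p t i ord0).
Proof. by case: Hp => + _ _ => /(_ i)[h _] t t0; apply/cvg_at_rightP; exact: h. Qed.

Lemma llim_input i : llim (fun t => p t i ord0).
Proof.
case: Hp => + _ _ => /(_ i)[_ h] t t0; have [l hl] := h t t0; exists l.
exact/cvg_at_leftP.
Qed.

Lemma rcont_free j : rcont (fun t => free p t j ord0).
Proof.
under eq_fun do rewrite freeE.
apply: rcontD; last exact: rcontZ (@rcont_id _).
apply: (@rcont_sum _ _ (fun i t => Q j i * p t i ord0)) => i; apply: rcontZ.
exact: rcont_input.
Qed.

Lemma llim_free j : llim (fun t => free p t j ord0).
Proof.
under eq_fun do rewrite freeE.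
apply: llimD; last exact: llimZ (@llim_id _).
apply: (@llim_sum _ _ (fun i t => Q j i * p t i ord0)) => i; apply: llimZ.
exact: llim_input.
Qed.

Lemma free0 : free p 0 = 0.
Proof. by rewrite /free; case: Hp => _ -> _; rewrite mulmx0 scale0r subr0. Qed.

(** The recursion for [Q] gives X_j = J_j + p_ij X_i + t (p_ij r_i - r_j): the first term is
    nondecreasing by (T2), as [j] is not the root, and the last one by (T1). *)
Lemma free_parent (i j : 'I_n) : (i < j)%N -> r j ord0 < P i j * r i ord0 ->
  (forall v : 'I_n -> R, \sum_k P k j * v k = P i j * v i) ->
  forall s t, 0 <= s -> s <= t ->
  P i j * (free p t i ord0 - free p s i ord0) <= free p t j ord0 - free p s j ord0.
Proof.
move=> ij rj hP s t s0 st.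
have fE u : free p u j ord0 = p u j ord0 + P i j * free p u i ord0 +
    u * (P i j * r i ord0 - r j ord0).
  rewrite !freeQ [in LHS]Q_recur (hP (fun k => (Q *m p u) k ord0)); ring.
have j0 : (0 < j)%N by exact: leq_ltn_trans ij.
have pj : p s j ord0 <= p t j ord0 by case: Hp => _ _; apply.
rewrite !fE.
have : 0 <= (t - s) * (P i j * r i ord0 - r j ord0).
  by rewrite mulr_ge0// subr_ge0// ltW.
lra.
Qed.

Definition shifted (y : E) j (t : R) := y j ord0 + free p t j ord0.
Definition regul (y : E) (t : R) : E := \col_j reg (shifted y j) t.
(** The vector V of the overview for a deterministic path, with [y] in the place of Q w; the buffer
    content is [IP *m content]. *)
Definition content (y : E) (t : R) : E := y + free p t + regul y t.

Variable y : E.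

Lemma rcont_shifted j : rcont (shifted y j).
Proof. exact: rcontD (rcont_cst _) (rcont_free j). Qed.

Lemma llim_shifted j : llim (shifted y j).
Proof. exact: llimD (llim_cst _) (llim_free j). Qed.

Lemma contentE j t : content y t j ord0 = shifted y j t + reg (shifted y j) t.
Proof. by rewrite /content [LHS]mxE [X in X + _]mxE [X in _ + X]mxE. Qed.

Lemma content_ge0 j t : 0 <= t -> 0 <= content y t j ord0.
Proof.
move=> t0; rewrite contentE.
have : - shifted y j t <= reg (shifted y j) t.
  by apply: (reg_ub (rcont_shifted j) (llim_shifted j)); rewrite t0 lexx.
lra.
Qed.

(** The reflection formula for V_j in terms of upper bounds; the case [u = t] contains the condition
    [0 <= c]. *)
Lemma content_le j t c : 0 <= t -> (content y t j ord0 <= c) <->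
  (shifted y j t <= c /\
   forall u, 0 <= u <= t -> free p t j ord0 - free p u j ord0 <= c).
Proof.
move=> t0; rewrite contentE.
have r1 := rcont_shifted j; have r2 := llim_shifted j.
split=> [h|[h1 h2]].
  split; first by have := reg_ge0 r1 r2 t; lra.
  by move=> u /(reg_ub r1 r2); rewrite /shifted in h *; lra.
suff : reg (shifted y j) t <= c - shifted y j t by lra.
apply: (reg_le r1 r2); first by rewrite subr_ge0.
by move=> u /h2; rewrite /shifted; lra.
Qed.

(** This will give W_j >= 0. An upper bound for V_j divided by [P i j] is one for V_i: by
    [free_parent], [P i j] times each quantity in the formula for V_i is at most its counterpart for
    V_j. *)
Lemma content_parent (i j : 'I_n) : (i < j)%N -> 0 < P i j -> r j ord0 < P i j * r i ord0 ->
  (forall v : 'I_n -> R, \sum_k P k j * v k = P i j * v i) ->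
  P i j * y i ord0 <= y j ord0 ->
  forall t, 0 <= t -> P i j * content y t i ord0 <= content y t j ord0.
Proof.
move=> ij p0 rj hP yij t t0; rewrite mulrC -ler_pdivlMr//.
have [h1 h2] := (content_le j (content y t j ord0) t0).1 (lexx _).
have hf := free_parent ij rj hP.
have f0 k : free p 0 k ord0 = 0 by rewrite free0 mxE.
apply/(content_le _ _ t0); split.
  rewrite ler_pdivlMr//; apply: le_trans h1.
  have := hf 0 t (lexx _) t0; rewrite !f0 !subr0 /shifted mulrC; lra.
move=> u /andP[u0 ut]; rewrite ler_pdivlMr// mulrC.
apply: le_trans (hf u t u0 ut) _.
by apply: h2; rewrite u0.
Qed.

End path.

Section skorokhod.
Variables (p : R -> E) (w : E).
Hypotheses (Hp : input_path p) (w0 : forall j, 0 <= w j ord0).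
Local Notation y := (Q *m w).

Let y_parent (i j : 'I_n) : (forall v : 'I_n -> R, \sum_k P k j * v k = P i j * v i) ->
  P i j * y i ord0 <= y j ord0.
Proof.
by move=> hP; rewrite [leRHS]Q_recur (hP (fun k => y k ord0)) lerDr.
Qed.

Lemma IP_content_ge0 t j : 0 <= t -> 0 <= (IP *m content p y t) j ord0.
Proof.
move=> t0; rewrite IPE.
have [h|[i [ij p0 rj hP]]] := tree_parent j.
  by rewrite (h (fun i => content p y t i ord0)) subr0 content_ge0.
rewrite (hP (fun i => content p y t i ord0)) subr_ge0.
by apply: content_parent => //; exact: y_parent.
Qed.

Lemma net_input_free t : w + net_input r P p t = IP *m (y + free p t).
Proof.
rewrite mulmxDr mulQ /net_input /free; congr (_ + _).
by rewrite mulmxBr mulQ scalemxAr.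
Qed.

Let y0 j : 0 <= shifted p y j 0.
Proof. by rewrite /shifted free0// [X in _ + X]mxE addr0 Q_ge0. Qed.

(** Parents come first. L_j dominates the regulator because V_j >= 0. Conversely, once the parent is
    identified, W_j is the difference bounded below in [content_parent] plus the excess of L_j over
    the regulator. So W_j is at least this excess, and [complementarity_le] excludes a positive
    one. *)
Lemma skorokhod_unique W L : buffer_content r P p w W L ->
  forall t, 0 <= t -> W t = IP *m content p y t.
Proof.
move=> sk.
have VE t : 0 <= t -> Q *m W t = y + free p t + L t.
  by move=> t0; rewrite (skorokhod_eq sk t0) net_input_free mulmxDr !mulIP.
have ndL j s t : 0 <= s -> s <= t -> L s j ord0 <= L t j ord0.
  by move=> s0 st; exact: (skorokhod_Lnd sk).
suff LE : forall j t, 0 <= t -> L t j ord0 = reg (shifted p y j) t.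
  move=> t t0; rewrite -[LHS]mulQ VE//; congr (IP *m _).
  rewrite /content; congr (_ + _); apply/colP => j.
  by rewrite LE// mxE.
apply: tree_ind => j ih t t0; apply/eqP; rewrite eq_le; apply/andP; split; last first.
  apply: (reg_le (rcont_shifted Hp y j) (llim_shifted Hp y j)).
    by rewrite (le_trans _ (ndL _ _ _ (lexx 0) t0))// (skorokhod_L0 sk) mxE.
  move=> u /andP[u0 ut]; apply: le_trans (ndL _ _ _ u0 ut).
  have : 0 <= (Q *m W u) j ord0 by apply: Q_ge0 => k; exact: (skorokhod_ge0 sk).
  by rewrite VE// /shifted !mxE; lra.
have [F [FL sum0]] := skorokhod_compl sk.
have int0 i : (0 <= \int[lebesgue_stieltjes_measure (F i)]_(t in `[0%R, +oo[)
    (W t i ord0)%:E)%E.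
  apply: integral_ge0 => x; rewrite /= in_itv/= andbT lee_fin => x0.
  exact: (skorokhod_ge0 sk).
have intj : (\int[lebesgue_stieltjes_measure (F j)]_(t in `[0%R, +oo[)
    (W t j ord0)%:E = 0)%E.
  apply/eqP; rewrite eq_le int0 andbT -sum0 (bigD1 j)//= leeDl// sume_ge0//.
(* The level [M] is the regulator at the final time [t], which bounds the regulator at every
   [u <= t]. *)
apply: (@complementarity_le _ (F j) (fun t => L t j ord0) (fun t => W t j ord0)) => //.
- by rewrite (skorokhod_L0 sk) mxE.
- move=> u u0; apply/cvg_at_rightP.
  by have [h _] := skorokhod_cadlagL sk j; exact: h.
- by move=> s u s0 su; exact: ndL.
- by move=> u u0; exact: (skorokhod_ge0 sk).
- exact: (reg_ge0 (rcont_shifted Hp y j) (llim_shifted Hp y j)).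
move=> u /andP[u0 ut].
have ru := reg_nd (rcont_shifted Hp y j) (llim_shifted Hp y j) ut.
have VEj i : (Q *m W u) i ord0 = shifted p y i u + L u i ord0.
  by rewrite VE// /shifted !mxE.
have := contentE p y j u.
have := Q_recur (W u) j; rewrite VEj.
have [h|[i [ij p0 rj hP]]] := tree_parent j.
  rewrite (h (fun i => (Q *m W u) i ord0)) => ? ?.
  by have := content_ge0 Hp y j u0; lra.
rewrite (hP (fun i => (Q *m W u) i ord0)) VEj (ih i ij u u0) -contentE.
have := content_parent Hp ij p0 rj hP (y_parent hP) u0.
lra.
Qed.

Lemma cumulativeP (g : R -> R) : (forall s t, s <= t -> g s <= g t) ->
  (forall t, g s @[s --> t^'+] --> g t) -> exists F : cumulative R R, forall t, F t = g t.
Proof.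
move=> ndg rg.
pose F : cumulative R R := HB.pack g (isCumulative.Build R _ R g ndg rg).
by exists F.
Qed.

(** [reg] is complementary to V_j while the condition concerns W_j; since W_j is V_j minus a
    nonnegative amount, W_j > 0 implies V_j > 0. *)
Lemma skorokhod_exists :
  buffer_content r P p w (fun t => IP *m content p y t) (regul p y).
Proof.
have rr j := rcont_shifted Hp y j; have rl j := llim_shifted Hp y j.
split.
- move=> j.
  have cE t : (IP *m content p y t) j ord0 =
      \sum_i IP j i * (shifted p y i t + reg (shifted p y i) t).
    by rewrite mxE; apply: eq_bigr => i _; rewrite contentE.
  under eq_fun do rewrite cE.
  split=> t t0.
    rewrite cE; apply/cvg_at_rightP.
    apply: (@rcont_sum _ _ (fun i t => IP j i * (shifted p y i t + reg (shifted p y i) t))) => // i.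
    by apply: rcontZ; apply: rcontD => //; exact: rcont_reg.
  have [l hl] := @llim_sum _ _ (fun i t => IP j i * (shifted p y i t + reg (shifted p y i) t))
    (fun i => llimZ (IP j i) (llimD (rl i) (llim_reg (rr i) (rl i)))) t t0.
  by exists l; exact/cvg_at_leftP.
- move=> j; under eq_fun do rewrite mxE.
  split=> t t0.
    by rewrite mxE; apply/cvg_at_rightP; exact: rcont_reg.
  by have [l hl] := llim_reg (rr j) (rl j) t0; exists l; exact/cvg_at_leftP.
- by move=> t t0; rewrite net_input_free /content mulmxDr.
- by move=> t t0 j; exact: IP_content_ge0.
- rewrite /content free0// addr0 (_ : regul p y 0 = 0) ?addr0 ?mulQ//.
  by apply/colP => j; rewrite !mxE (reg0 (rr j) (rl j) (y0 j)).
- by apply/colP => j; rewrite !mxE (reg0 (rr j) (rl j) (y0 j)).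
- by move=> s t s0 st j; rewrite !mxE; exact: (reg_nd (rr j) (rl j)).
have hF j : exists F : cumulative R R, forall t, F t = reg (shifted p y j) (Num.max t 0).
  apply: cumulativeP => [s t st|t].
    by apply: (reg_nd (rr j) (rl j)); rewrite ge_max !le_max st lexx orbT.
  apply/cvg_at_rightP => e e0; have [t0|t0] := leP 0 t.
    have [d d0 hd] := rcont_reg (rr j) (rl j) t0 e0; exists d => // s /andP[ts sd].
    rewrite !(max_idPl _)//; last by rewrite (le_trans t0)// ltW.
    by apply: hd; rewrite ts.
  exists (- t); first by rewrite oppr_gt0.
  move=> s /andP[ts]; rewrite subrr => s0.
  by rewrite !(max_idPr _) ?subrr ?normr0// ltW.
have [F FE] := choice hF; exists F; split.
  by move=> j t; rewrite FE mxE.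
rewrite big1// => j _; apply: (@reg_complementary _ (shifted p y j)) => //.
- by move=> t t0; exact: IP_content_ge0.
- move=> t t0 W0; rewrite -contentE; apply: lt_le_trans W0 _.
  rewrite IPE gerBl; apply: sumr_ge0 => i _.
  by rewrite mulr_ge0// ?content_ge0// (tree_routing_ge0 Htree).
Qed.

End skorokhod.

Definition pshift (p : R -> E) (s t : R) : E := p (s + tpos t) - p s.

Lemma input_path_shift p s : 0 <= s -> input_path p -> input_path (pshift p s).
Proof.
move=> s0 [cp p0 ndp]; split.
- move=> i; have [h1 h2] := cp i.
  have pE u : 0 <= u -> pshift p s u i ord0 = p (s + u) i ord0 - p s i ord0.
    by move=> u0; rewrite /pshift tpos_id// [LHS]mxE; congr (_ + _); rewrite mxE.
  split => t t0.
    apply/cvg_at_rightP => e e0.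
    have st0 : 0 <= s + t by rewrite addr_ge0.
    have /cvg_at_rightP/(_ e e0)[d d0 hd] := h1 _ st0.
    exists d => // u /andP[tu ud]; rewrite !pE//; last by rewrite (le_trans t0)// ltW.
    rewrite opprB addrA subrK; apply: hd; rewrite ltrD2l tu -addrA ltrD2l//.
  have st0 : 0 < s + t by rewrite ltr_wpDl.
  have [l /cvg_at_leftP hl] := h2 _ st0.
  exists (l - p s i ord0); apply/cvg_at_leftP => e e0.
  have [d d0 hd] := hl _ e0; exists (Num.min d t); first by rewrite lt_min d0.
  move=> u /andP[tu ut].
  have u0 : 0 < u by apply: le_lt_trans tu; rewrite subr_ge0 ge_min lexx orbT.
  rewrite pE ?ltW// opprB addrA subrK; apply: hd; rewrite ltrD2l ut andbT -addrA ltrD2l.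
  by apply: le_lt_trans tu; rewrite lerD2l lerN2 ge_min lexx.
- by rewrite /pshift tpos_id// addr0 subrr.
- move=> j j0 u t u0 ut; rewrite /pshift !mxE lerD2r !tpos_id ?(le_trans u0)//.
  by apply: ndp => //; rewrite ?addr_ge0// lerD2l.
Qed.

Lemma free_pshift p s t : 0 <= s -> 0 <= t ->
  free (pshift p s) t = free p (s + t) - free p s.
Proof.
move=> s0 t0; rewrite /free /pshift tpos_id// mulmxBr.
move: (Q *m p (s + t)) (Q *m p s) => a b.
by apply/colP => j; rewrite !mxE; ring.
Qed.

(** The supremum in the formula at time [s + t] splits at [s]: the earlier times give the content at
    [s] carried forward by X, the later ones the increments of the shifted path. *)
Lemma content_flow p y s t : input_path p -> 0 <= s -> 0 <= t ->
  content p y (s + t) = content (pshift p s) (content p y s) t.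
Proof.
move=> Hp s0 t0; have Hs := input_path_shift s0 Hp.
have st0 : 0 <= s + t by rewrite addr_ge0.
apply/colP => j; apply: eq_le_bounds => c.
rewrite (content_le Hp)// (content_le Hs)// /shifted.
have fE u : 0 <= u -> free (pshift p s) u j ord0 = free p (s + u) j ord0 - free p s j ord0.
  by move=> u0; rewrite free_pshift// !mxE.
rewrite fE//.
rewrite -[X in _ <-> (is_true X /\ _)]lerBrDr (content_le Hp)// /shifted.
split.
- move=> [h1 h2]; split; first split; first lra.
    move=> u /andP[u0 us]; have := h2 u; rewrite u0 (le_trans us) ?lerDl// => /(_ erefl); lra.
  move=> u /andP[u0 ut]; rewrite fE//.
  by have := h2 (s + u); rewrite lerD2l ut addr_ge0// => /(_ erefl); lra.
- move=> [[h1 h2] h3]; split; first lra.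
  move=> u /andP[u0 us]; have [us'|su] := leP u s.
    by have := h2 u; rewrite u0 us' => /(_ erefl); lra.
  have u'0 : 0 <= u - s by rewrite subr_ge0 ltW.
  have su' : s + (u - s) = u by rewrite addrC subrK.
  have := h3 (u - s); rewrite u'0 lerBlDl us fE// su' => /(_ erefl).
  lra.
Qed.

End tree.

Arguments content_le {R n r P p} Hp y j {t} c _.
Arguments free0 {R n r P p} Hp.
Arguments free_pshift {R n r P} p {s t} _ _.

(** * Contents and suprema as functionals on path space *)

Section countable_sup.
Context (R : realType).

(* Equal to 0 when [f] is unbounded, like [sup]. *)
Definition csup (f : nat -> R) : R := fine (ereal_sup (range (fun m => (f m)%:E))).

Lemma csup_le (f : nat -> R) (M c : R) : (forall m, f m <= M) ->
  (csup f <= c) <-> (forall m, f m <= c).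
Proof.
move=> fM; rewrite /csup; set S := ereal_sup _.
have SM : (S <= M%:E)%E by apply: ge_ereal_sup => _ [m _ <-]; rewrite lee_fin.
have S0 : ((f 0%N)%:E <= S)%E by apply: ereal_sup_ubound; exists 0%N.
have Sfin : S \is a fin_num.
  rewrite fin_numElt (lt_le_trans (ltNyr (f 0%N)) S0) /=.
  exact: le_lt_trans SM (ltry _).
rewrite -lee_fin fineK//; split=> [h m|h].
  by rewrite -lee_fin; apply: le_trans h; apply: ereal_sup_ubound; exists m.
by apply: ge_ereal_sup => _ [m _ <-]; rewrite lee_fin.
Qed.

Lemma csup_out (f : nat -> R) : ~ (exists M, forall m, f m <= M) -> csup f = 0.
Proof.
move=> h; rewrite /csup (_ : ereal_sup _ = +oo%E)//.
apply/eqP; rewrite eq_le leey /= leNgt; apply/negP => h1; apply: h.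
set S := ereal_sup _ in h1; exists (fine S) => m.
have S0 : ((f m)%:E <= S)%E by apply: ereal_sup_ubound; exists m.
rewrite -lee_fin fineK// fin_numElt h1 andbT.
exact: (lt_le_trans (ltNyr (f m)) S0).
Qed.

Lemma measurable_csup d (T : measurableType d) (f : nat -> T -> R) :
  (forall m, measurable_fun setT (f m)) -> measurable_fun setT (fun x => csup (f ^~ x)).
Proof.
move=> mf; apply: measurableT_comp => //.
rewrite (_ : (fun x => _) = (fun x => esups (fun m => (f m x)%:E) 0%N)).
  apply: (@measurable_fun_esups _ _ _ _ (fun m x => (f m x)%:E)) => m.
  exact/measurable_EFinP.
apply/funext => x; rewrite /esups; congr ereal_sup; apply/seteqP; split.
  by move=> _ [m _ <-]; exists m.
by move=> _ [m _ <-]; exists m.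
Qed.

End countable_sup.

Section functionals.
Context (R : realType) (n : nat) (r : 'cV[R]_n) (P : 'M[R]_n).
Hypothesis Htree : tree_network r P.
Hypothesis T1 : forall i j, 0 < P i j -> r j ord0 / r i ord0 < P i j.
Local Notation E := 'cV[R]_n.
Local Notation IP := (1%:M - P^T).
Local Notation Q := (invmx IP).
Local Notation free := (free r P).
Local Notation content := (content r P).

(* At the path reversed at [s] this is the content started from [y]; at the path
   stopped at [s] it relates the suprema of [X] before and after [s]. *)
Definition Ufun (s : R) (y : E) (q : fspace R E) : E :=
  \col_j Num.max (y j ord0 + free q s j ord0)
    (csup (fun m => free q (tclip s (dyad R m)) j ord0)).

(** Dyadic times make this measurable on path space; [Xbar_sup] identifies it with the true supremum
    on cadlag paths. *)
Definition Xbar (q : fspace R E) : E :=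
  \col_j csup (fun m => free q (dyad R m) j ord0).

Lemma measurable_free d (T : measurableType d) (g : T -> fspace R E) t j :
  measurable_fun setT g -> measurable_fun setT (fun x => free (g x) t j ord0).
Proof.
move=> mg; rewrite (_ : (fun _ => _) = fun x => (Q *m g x t) j ord0 - t * r j ord0).
  apply: measurable_funB => //.
  apply: (measurableT_comp (measurable_coord j)); apply: measurable_mulmxl.
  by apply: (measurableT_comp (@measurable_eval R _ E t)).
by apply/funext => x; rewrite freeQ.
Qed.

Lemma measurable_Xbar : measurable_fun setT Xbar.
Proof.
apply: measurable_fun_cV => j; under eq_fun do rewrite mxE.
by apply: measurable_csup => m; apply: (@measurable_free _ _ id); exact: measurable_id.
Qed.

Lemma measurable_Ufun s : measurable_fun setT (fun yq : E * fspace R E => Ufun s yq.1 yq.2).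
Proof.
apply: measurable_fun_cV => j; under eq_fun do rewrite mxE.
have m2 : measurable_fun setT (fun yq : E * fspace R E => yq.2) by exact: measurable_snd.
apply: measurable_maxr.
  apply: measurable_funD; last exact: measurable_free.
  by apply: (measurableT_comp (measurable_coord j)); exact: measurable_fst.
by apply: measurable_csup => m; exact: measurable_free.
Qed.

Section path.
Variable p : R -> E.
Hypothesis Hp : input_path p.

Lemma free_bounded (s : R) j : 0 <= s -> exists M, forall u, 0 <= u <= s ->
  `|free p u j ord0| <= M.
Proof.
move=> s0.
have [M1 h1] := rcll_bounded (rcont_free r P Hp j) (llim_free r P Hp j) s0.
have [M2 h2] := rcll_bounded (rcontZ (-1) (rcont_free r P Hp j))
  (llimZ (-1) (llim_free r P Hp j)) s0.
exists (Num.max M1 M2) => u us; rewrite ler_norml le_max h1// andbT.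
have := h2 u us; rewrite mulN1r lerNl => h; apply: le_trans h.
by rewrite lerN2 le_max lexx orbT.
Qed.

Lemma tclip_dyad_dense (s u e : R) : 0 <= u < s -> 0 < e ->
  exists2 v, u < v < u + e & exists m, v = tclip s (dyad R m).
Proof.
move=> /andP[u0 us] e0.
have me : 0 < Num.min e (s - u) by rewrite lt_min e0 subr_gt0.
have [m /andP[um md]] := dyad_dense u0 me.
have m1 : Num.min e (s - u) <= e by rewrite ge_min lexx.
have m2 : Num.min e (s - u) <= s - u by rewrite ge_min lexx orbT.
exists (dyad R m); first by rewrite um /=; lra.
exists m; rewrite tclip_id// dyad_ge0/=; lra.
Qed.

Lemma tclip_dyad_end (s : R) : 0 <= s -> exists m, s = tclip s (dyad R m).
Proof.
move=> s0; have [m /andP[sm _]] := dyad_dense s0 ltr01.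
by exists m; apply/esym/min_idPl; rewrite tpos_id ?dyad_ge0// ltW.
Qed.

(** On the path reversed at [s], X becomes X(s) - X(s - t), so its supremum over [0, s] is that of
    X(s) - X(u) in the reflection formula. *)
Lemma content_Ufun y (s : R) : 0 <= s ->
  content p y s = Ufun s y (fun t => p s - p (s - tclip s t)).
Proof.
move=> s0; apply/colP => j; apply: eq_le_bounds => c.
rewrite (content_le Hp)// [in X in _ <-> X]mxE ge_max.
have fE t : 0 <= t <= s -> free (fun t => p s - p (s - tclip s t)) t j ord0 =
    free p s j ord0 - free p (s - t) j ord0.
  move=> ts; rewrite !freeQ tclip_id// mulmxBr [X in X - _]mxE [X in _ + X - _]mxE; ring.
have [M hM] := free_bounded j s0.
have bd m : free (fun t => p s - p (s - tclip s t)) (tclip s (dyad R m)) j ord0 <= M + M.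
  have /andP[c0 cs] := tclip_itv (dyad R m) s0.
  rewrite fE ?c0//.
  have := hM s; rewrite s0 lexx => /(_ erefl); rewrite ler_norml => /andP[_ ?].
  have := hM (s - tclip s (dyad R m)).
  rewrite subr_ge0 cs gerBl c0 => /(_ erefl); rewrite ler_norml => /andP[? _]; lra.
rewrite fE ?s0 ?lexx// subrr (free0 Hp) [X in _ - X]mxE subr0 /shifted.
split=> [[h1 h2]|/andP[h1 /(csup_le _ bd) h2]].
  rewrite h1 /=; apply/(csup_le _ bd) => m.
  have /andP[c0 cs] := tclip_itv (dyad R m) s0.
  by rewrite fE ?c0//; apply: h2; rewrite subr_ge0 cs gerBl.
split => //.
apply: (@rcont_le_dense _ (fun u => free p s j ord0 - free p u j ord0) s c
  [set v | exists m, v = s - tclip s (dyad R m)]).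
- apply: rcontD; first exact: rcont_cst.
  rewrite (_ : (fun t => _) = (fun t => -1 * free p t j ord0)); last first.
    by apply/funext => t; rewrite mulN1r.
  exact/rcontZ/rcont_free.
- move=> _ [m ->]; have := h2 m.
  by rewrite fE// tclip_itv.
- have [m hm] := dyad0 R; exists m; rewrite hm tclip_id ?lexx// subr0//.
- move=> u e /andP[u0 us] e0.
  (* A dyadic strictly between the maximum of 0 and [s - u - e] and the number [s - u] is subtracted
     from [s], so that [u] is approached from the right. *)
  have a0 : 0 <= Num.max 0 (s - u - e) by rewrite le_max lexx.
  have b0 : 0 < s - u - Num.max 0 (s - u - e).
    by rewrite subr_gt0 gt_max subr_gt0 us /= gtrBl.
  have [m /andP[um md]] := dyad_dense a0 b0.
  have m1 : s - u - e <= Num.max 0 (s - u - e) by rewrite le_max lexx orbT.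
  exists (s - dyad R m); first by apply/andP; split; lra.
  exists m; rewrite tclip_id// dyad_ge0 /=; lra.
Qed.

Lemma free_le_dyad j c : (forall m, free p (dyad R m) j ord0 <= c) ->
  forall t, 0 <= t -> free p t j ord0 <= c.
Proof.
move=> h t t0; have [m /andP[tm _]] := dyad_dense t0 ltr01.
apply: (@rcont_le_dense _ (fun u => free p u j ord0) (dyad R m) c
  [set v | exists m, v = dyad R m]).
- exact: rcont_free.
- by move=> _ [k ->].
- by exists m.
- move=> u e /andP[u0 _] e0; have [k hk] := dyad_dense u0 e0.
  by exists (dyad R k) => //; exists k.
- by rewrite t0 ltW.
Qed.

Definition free_set (j : 'I_n) : set R :=
  [set free p t j ord0 | t in [set t | 0 <= t]].

Lemma has_sup_freeP j : has_sup (free_set j) <->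
  exists M, forall m, free p (dyad R m) j ord0 <= M.
Proof.
split=> [[_ [M hM]]|[M hM]].
  by exists M => m; apply: hM; exists (dyad R m) => //; exact: dyad_ge0.
split; first by exists (free p 0 j ord0), 0 => //=; rewrite lexx.
by exists M => _ [t t0 <-]; exact: free_le_dyad.
Qed.

(** Also valid where X is unbounded above: both suprema are then 0 by convention. *)
Lemma Xbar_sup : Xbar (fun t => p (tpos t)) = \col_j sup (free_set j).
Proof.
apply/colP => j; rewrite !mxE.
rewrite (_ : (fun m => _) = fun m => free p (dyad R m) j ord0); last first.
  by apply/funext => m; rewrite !freeQ tpos_id ?dyad_ge0.
have [h|h] := pselect (has_sup (free_set j)); last first.
  by rewrite sup_out// csup_out// => /has_sup_freeP.
have [M hM] := (has_sup_freeP j).1 h.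
apply: eq_le_bounds => c; rewrite (csup_le _ hM); split=> hc.
  by apply: ge_sup; [case: h|move=> _ [t t0 <-]; exact: free_le_dyad].
move=> m; apply: le_trans hc; apply: ub_le_sup; first by case: h.
by exists (dyad R m) => //; exact: dyad_ge0.
Qed.

Hypothesis Hsup : forall j, has_sup (free_set j).

Lemma Xbar_le j c : (Xbar (fun t => p (tpos t)) j ord0 <= c) <->
  (forall t, 0 <= t -> free p t j ord0 <= c).
Proof.
rewrite Xbar_sup mxE; split=> h.
  move=> t t0; apply: le_trans h; apply: ub_le_sup; last by exists t.
  by case: (Hsup j).
by apply: ge_sup; [case: (Hsup j)|move=> _ [t t0 <-]; exact: h].
Qed.

(** Makes (I - P') sup X an admissible initial content. The comparison is that of [content_parent]
    with an infinite horizon; at the root it suffices that X starts at 0. *)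
Lemma Xbar_parent_ge0 j : 0 <= (IP *m Xbar (fun t => p (tpos t))) j ord0.
Proof.
set Z := Xbar _; rewrite IPE.
have Zt k t : 0 <= t -> free p t k ord0 <= Z k ord0.
  by move=> t0; have := (Xbar_le k (Z k ord0)).1 (lexx _) t t0.
have f0 k : free p 0 k ord0 = 0 by rewrite free0// mxE.
have [h|[i [ij p0 rj hP]]] := tree_parent Htree T1 j.
  by rewrite (h (fun i => Z i ord0)) subr0 -(f0 j) Zt.
rewrite (hP (fun i => Z i ord0)) subr_ge0 mulrC -ler_pdivlMr//.
apply/Xbar_le => t t0; rewrite ler_pdivlMr// mulrC; apply: le_trans (Zt j t t0).
by have := free_parent Htree Hp ij rj hP (lexx 0) t0; rewrite !f0 !subr0.
Qed.

(** The supremum over all times is the larger of the one up to [s] and of X(s) plus the one of the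
    shifted path: the pathwise fixed-point equation behind invariance. *)
Lemma Ufun_Xbar (s : R) : 0 <= s ->
  Ufun s (Xbar (pshift p s)) (fun t => p (tclip s t)) = Xbar (fun t => p (tpos t)).
Proof.
move=> s0; apply/colP => j; apply: eq_le_bounds => c; rewrite Xbar_le.
rewrite mxE ge_max.
have fE t : 0 <= t <= s -> free (fun t => p (tclip s t)) t j ord0 = free p t j ord0.
  by move=> ts; rewrite !freeQ tclip_id.
have shE t : 0 <= t -> free (pshift p s) t j ord0 = free p (s + t) j ord0 - free p s j ord0.
  move=> t0; rewrite free_pshift// [LHS]mxE; congr (_ + _); rewrite mxE//.
have [M hM] := free_bounded j s0.
have bd m : free (fun t => p (tclip s t)) (tclip s (dyad R m)) j ord0 <= M.
  rewrite fE ?tclip_itv//; have := hM _ (tclip_itv (dyad R m) s0).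
  by rewrite ler_norml => /andP[].
have [Z hZ] := (has_sup_freeP j).1 (Hsup j).
have bd2 m : free (pshift p s) (dyad R m) j ord0 <= Z - free p s j ord0.
  rewrite shE ?dyad_ge0// lerD2r; apply: free_le_dyad => //.
  by rewrite addr_ge0// dyad_ge0.
rewrite fE ?s0 ?lexx// -lerBrDr [X in X <= _]mxE.
split=> [/andP[/(csup_le _ bd2) h1 /(csup_le _ bd) h2] t t0|h].
  have [ts|st] := leP t s.
    apply: (@rcont_le_dense _ (fun u => free p u j ord0) s c
      [set v | exists m, v = tclip s (dyad R m)]).
    - exact: rcont_free.
    - by move=> _ [m ->]; have := h2 m; rewrite fE// tclip_itv.
    - exact: tclip_dyad_end.
    - by move=> u e; exact: tclip_dyad_dense.
    - by rewrite t0.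
  have Hs := input_path_shift s0 Hp.
  have ts0 : 0 <= t - s by rewrite subr_ge0 ltW.
  have sts : s + (t - s) = t by rewrite addrC subrK.
  (* A dyadic beyond [t - s] serves as right end, since [rcont_le_dense] wants that end in the dense
     set. *)
  have : free (pshift p s) (t - s) j ord0 <= c - free p s j ord0.
    apply: (@rcont_le_dense _ (fun u => free (pshift p s) u j ord0)
      (dyad R (xchoose (dyad_dense ts0 ltr01))) _
      [set v | exists m, v = dyad R m]).
    - exact: rcont_free.
    - by move=> _ [k ->].
    - by eexists.
    - move=> u e /andP[u0 _] e0; have [k hk] := dyad_dense u0 e0.
      by exists (dyad R k) => //; exists k.
    - have /andP[h _] := xchooseP (dyad_dense ts0 ltr01).
      by rewrite ts0 ltW.
  by rewrite shE// sts lerD2r.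
apply/andP; split.
  apply/(csup_le _ bd2) => m; rewrite shE ?dyad_ge0// lerD2r; apply: h.
  by rewrite addr_ge0// dyad_ge0.
apply/(csup_le _ bd) => m; rewrite fE ?tclip_itv//; apply: h.
by have /andP[] := tclip_itv (dyad R m) s0.
Qed.

End path.

(** When y + X(s) <= 0, the initial state loses in the maximum to the term [u = s], whose value is
    0. *)
Lemma content_coupling p (y y' : E) (s : R) : input_path p -> 0 <= s ->
  (forall j, y j ord0 + free p s j ord0 <= 0) ->
  (forall j, y' j ord0 + free p s j ord0 <= 0) -> content p y s = content p y' s.
Proof.
move=> Hp s0 hy hy'; apply/colP => j; apply: eq_le_bounds => c.
rewrite !(content_le Hp)// /shifted; split=> -[_ h]; split => //.
  have := h s; rewrite s0 lexx subrr => /(_ erefl); exact: le_trans.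
have := h s; rewrite s0 lexx subrr => /(_ erefl); exact: le_trans.
Qed.

End functionals.

(** * Negative drift *)

Section law_integral.
Local Open Scope ereal_scope.
Context d (T : measurableType d) (R : realType) (mu : {measure set T -> \bar R}).

Lemma ge0_integral_law d1 (S : measurableType d1) (f1 f2 : T -> S) (B : set S)
    (g : S -> \bar R) :
  measurable_fun setT f1 -> measurable_fun setT f2 -> measurable B ->
  measurable_fun setT g -> (forall x, 0 <= g x) ->
  (forall A, measurable A -> mu (f1 @^-1` A) = mu (f2 @^-1` A)) ->
  \int[mu]_(x in f1 @^-1` B) g (f1 x) = \int[mu]_(x in f2 @^-1` B) g (f2 x).
Proof.
move=> mf1 mf2 mB mg g0 h.
have mgB : measurable_fun B g by exact: measurable_funS mg.
have e1 := @ge0_integral_pushforward _ _ _ _ _ f1 mf1 mu B g mB mgB (fun y _ => g0 y).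
have e2 := @ge0_integral_pushforward _ _ _ _ _ f2 mf2 mu B g mB mgB (fun y _ => g0 y).
rewrite -[LHS]/(integral mu (f1 @^-1` B) (g \o f1)) -e1.
rewrite -[RHS]/(integral mu (f2 @^-1` B) (g \o f2)) -e2.
by apply: eq_measure_integral => A mA _; exact: h.
Qed.

End law_integral.

Section indep_integral.
Local Open Scope ereal_scope.
Context d (T : measurableType d) (R : realType) (Pr : probability T R).
Variables (H : set T) (X : T -> R).
Hypotheses (mH : measurable H) (mX : measurable_fun setT X).
Hypothesis XH : forall B, measurable B -> Pr (X @^-1` B `&` H) = Pr H * Pr (X @^-1` B).

Let ge0_indep_integral (g : R -> \bar R) : measurable_fun setT g ->
  (forall x, 0 <= g x) -> \int[Pr]_(x in H) g (X x) = Pr H * \int[Pr]_x g (X x).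
Proof.
move=> mg g0; pose m := mrestr Pr mH : {measure set T -> \bar R}.
have nH : (0 <= fine (Pr H))%R by exact: fine_ge0.
have mgX : measurable_fun setT (g \o X) by exact: measurableT_comp.
transitivity (\int[m]_(x in H) g (X x)).
  by apply: eq_measure_integral => A mA AH; rewrite /m /= /mrestr setIidl.
transitivity (\int[m]_x g (X x)).
  rewrite [RHS](@ge0_negligible_integral _ _ _ _ _ (~` H))//.
  - by rewrite setTD setCK.
  - exact: measurableC.
  - by rewrite /m /= /mrestr setICl measure0.
have e1 := @ge0_integral_pushforward _ _ _ _ _ X mX m setT g measurableT mg (fun y _ => g0 y).
have e2 := @ge0_integral_pushforward _ _ _ _ _ X mX Pr setT g measurableT mg (fun y _ => g0 y).
rewrite preimage_setT in e1 e2.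
rewrite -[LHS]/(integral m setT (g \o X)) -e1.
rewrite -[X in _ * X]/(integral Pr setT (g \o X)) -e2.
rewrite -(@fineK _ (Pr H)) ?fin_num_measure//.
pose p2 := (pushforward Pr X : {measure set R -> \bar R}).
rewrite -(@ge0_integral_mscale _ _ _ (p2 mX) setT measurableT (NngNum nH) g)//.
apply: eq_measure_integral => A mA _.
by rewrite /m /= /mscale /= /pushforward /mrestr/= fineK ?fin_num_measure// XH.
Qed.

Lemma indep_integral : Pr.-integrable setT (EFin \o X) ->
  \int[Pr]_(x in H) (X x)%:E = Pr H * \int[Pr]_x (X x)%:E.
Proof.
move=> iX; rewrite integralE [in RHS]integralE.
have mE : measurable_fun setT (@EFin R) by [].
have mp : measurable_fun setT (fun x : R => ((@EFin R)^\+ x)).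
  exact: measurable_funepos.
have mn : measurable_fun setT (fun x : R => ((@EFin R)^\- x)).
  exact: measurable_funeneg.
have ep : \int[Pr]_(x in H) (EFin \o X)^\+ x = Pr H * \int[Pr]_x (EFin \o X)^\+ x.
  have := ge0_indep_integral mp (fun x => funepos_ge0 (@EFin R) x).
  under eq_integral do rewrite funeposE; under [in X in _ * X]eq_integral do rewrite funeposE.
  move=> h; under eq_integral do rewrite funeposE.
  by under [in X in _ * X]eq_integral do rewrite funeposE.
have en : \int[Pr]_(x in H) (EFin \o X)^\- x = Pr H * \int[Pr]_x (EFin \o X)^\- x.
  have := ge0_indep_integral mn (fun x => funeneg_ge0 (@EFin R) x).
  under eq_integral do rewrite funenegE; under [in X in _ * X]eq_integral do rewrite funenegE.
  move=> h; under eq_integral do rewrite funenegE.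
  by under [in X in _ * X]eq_integral do rewrite funenegE.
rewrite ep en -muleBr//; first exact: fin_num_measure.
exact: integrable_add_def.
Qed.

End indep_integral.

Section negative_drift.
Context (R : realType) (n : nat) d (T : measurableType d) (Pr : probability T R).
Local Notation E := 'cV[R]_n.
Variables (J : R -> T -> E) (r : E) (P : 'M[R]_n) (k : 'I_n).
Hypothesis HJ : levy_process Pr J.
Local Notation free := (free r P).

Definition walk (t : R) (x : T) : R := free (J ^~ x) t k ord0.

Lemma walk_path t x : 0 <= t -> free (path_of J x) t k ord0 = walk t x.
Proof. by move=> t0; rewrite /walk !freeQ /path_of tpos_id. Qed.

Lemma walk_stop s t x : 0 <= t <= s -> free (stop_of J s x) t k ord0 = walk t x.
Proof. by move=> ts; rewrite /walk !freeQ /stop_of tclip_id. Qed.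

Lemma walk_shift s t x : 0 <= s -> 0 <= t ->
  free (shift_of J s x) t k ord0 = walk (s + t) x - walk s x.
Proof.
move=> s0 t0; rewrite /walk.
rewrite (_ : shift_of J s x = pshift (J ^~ x) s)//.
by rewrite free_pshift// [LHS]mxE; congr (_ + _); rewrite mxE.
Qed.

Lemma measurable_walk t : 0 <= t -> measurable_fun setT (walk t).
Proof.
move=> t0; rewrite (_ : walk t = fun x => free (path_of J x) t k ord0).
  exact/measurable_free/(measurable_path_of HJ).
by apply/funext => x; rewrite walk_path.
Qed.

Fixpoint running_max (q : fspace R E) (m : nat) : R :=
  if m is m'.+1 then Num.max (running_max q m') (free q m%:R k ord0) else 0.

Lemma running_max_ge0 q m : 0 <= running_max q m.
Proof. by elim: m => //= m ih; rewrite le_max ih. Qed.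

Lemma running_max_ub q m j : (0 < j <= m)%N -> free q j%:R k ord0 <= running_max q m.
Proof.
elim: m => [|m ih] /=; first by case: j.
move=> /andP[j0]; rewrite leq_eqVlt => /predU1P[->|jm]; first by rewrite le_max lexx orbT.
by rewrite le_max ih// j0 -ltnS.
Qed.

(** Lindley's recursion: time 0 is split off, and the later values are [walk 1 x] plus those of the
    path shifted by one. *)
Lemma running_max_shift x m : running_max (path_of J x) m.+1 =
  Num.max 0 (walk 1 x + running_max (shift_of J 1 x) m).
Proof.
elim: m => [|m ih]; first by rewrite /= mulr1n addr0 walk_path ?ler01.
have -> : running_max (path_of J x) m.+2 =
  Num.max (running_max (path_of J x) m.+1) (walk m.+2%:R x) by rewrite -[in RHS]walk_path ?ler0n.
rewrite ih [running_max (shift_of _ _ _) m.+1]/= addr_maxr maxA walk_shift//.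
by rewrite [walk 1 x + (_ - _)]addrC subrK nat1r.
Qed.

Lemma measurable_running_max m : measurable_fun setT (running_max ^~ m).
Proof.
elim: m => [|m ih] /=; first exact: measurable_cst.
by apply: measurable_maxr => //; apply: (@measurable_free _ _ _ _ _ _ id); exact: measurable_id.
Qed.

Hypothesis intJ : forall t j, 0 <= t -> Pr.-integrable setT (fun x => (J t x j ord0)%:E).

Lemma integrable_walk t : 0 <= t -> Pr.-integrable setT (fun x => (walk t x)%:E).
Proof.
move=> t0.
rewrite (_ : (fun x => _) = (fun x => (\sum_j (invmx (1%:M - P^T) k j)%:E * (J t x j ord0)%:E
   - (t * r k ord0)%:E)%E)).
  apply: integrableB => //.
    by apply: integrable_sum => // j _; apply: integrableZl => //; exact: intJ.
  exact: finite_measure_integrable_cst.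
apply/funext => x; rewrite /walk freeQ mxE EFinB; congr (_ - _)%E.
by rewrite -sumEFin; apply: eq_bigr => j _; rewrite EFinM.
Qed.

Lemma integrable_running_max m :
  Pr.-integrable setT (fun x => (running_max (path_of J x) m)%:E).
Proof.
elim: m => [|m ih] /=; first exact: finite_measure_integrable_cst.
have iw : Pr.-integrable setT (fun x => (walk m.+1%:R x)%:E) by exact: integrable_walk.
apply: (@le_integrable _ _ _ _ _ _ _
  (fun x => `|(running_max (path_of J x) m)%:E| + `|(walk m.+1%:R x)%:E|)%E) => //.
- apply/measurable_EFinP.
  have := measurableT_comp (@measurable_running_max m.+1) (measurable_path_of HJ).
  exact.
- move=> x _; rewrite walk_path// -!EFinD !abse_EFin lee_fin.
  rewrite [leRHS]ger0_norm ?addr_ge0//.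
  rewrite /Num.max; case: ifP => _; rewrite ?lerDl ?lerDr//.
- by apply: integrableD => //; exact: integrable_abse.
Qed.

Lemma measurable_walkN t c : 0 <= t -> measurable [set x | walk t x < c].
Proof.
move=> t0.
have := measurable_preimage (measurable_walk t0) (measurable_itv `]-oo, c[).
by congr measurable; apply/seteqP; split => x /=; rewrite in_itv.
Qed.

Definition unbounded_walk : set (fspace R E) :=
  \bigcap_(N : nat) \bigcup_(m : nat) [set q | N%:R < free q m%:R k ord0].

Lemma measurable_unbounded_walk : measurable unbounded_walk.
Proof.
apply: bigcapT_measurable => N; apply: bigcupT_measurable => m.
have mf : measurable_fun setT (fun q : fspace R E => free q m%:R k ord0).
  by apply: (@measurable_free _ _ _ _ _ _ id); exact: measurable_id.
have := measurable_preimage mf (measurable_itv `]N%:R, +oo[).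
by congr measurable; apply/seteqP; split => x /=; rewrite in_itv/= andbT.
Qed.

Lemma nat_above (c : R) : exists N : nat, c <= N%:R.
Proof. by exists (Num.truncn c).+1; rewrite ltW// truncnS_gt. Qed.

(** Shifting by one time unit changes all later values by the finite amount [walk 1 x]. The ergodic
    argument needs this invariance. *)
Lemma unbounded_walk_shift :
  shift_of J 1 @^-1` unbounded_walk = path_of J @^-1` unbounded_walk.
Proof.
apply/seteqP; split => x h N _.
  have [N' hN'] := nat_above (N%:R - walk 1 x).
  have [m _] := h N' Logic.I.
  rewrite /= walk_shift// => hm; exists m.+1 => //=.
  by rewrite walk_path// -nat1r; lra.
(* The bound [walk 0 x] in the maximum excludes [m = 0], a time that the shifted path does not
   see. *)
have [N' hN'] := nat_above (Num.max (N%:R + walk 1 x) (walk 0 x)).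
move: hN'; rewrite ge_max => /andP[h1 h2].
have [[|m] _] := h N' Logic.I; rewrite /= walk_path// => hm; first lra.
by exists m => //=; rewrite walk_shift// nat1r; lra.
Qed.

Hypothesis drift : (\int[Pr]_x (walk 1 x)%:E < 0)%E.

(* Maximal ergodic argument: [M_(m+1) - M_m o shift = max (- M_m o shift) (walk 1)]
   has nonnegative integral over the shift invariant event of unboundedness, on
   which it tends to [walk 1]; that event is independent of [walk 1]. *)
Lemma walk_bounded : Pr (path_of J @^-1` unbounded_walk) = 0%E.
Proof.
set A := (X in Pr X).
have mA : measurable A.
  exact: measurable_preimage (measurable_path_of HJ) measurable_unbounded_walk.
have AE : A = shift_of J 1 @^-1` unbounded_walk by rewrite unbounded_walk_shift.
have msh := measurable_shift_of HJ ler01.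
have mph := measurable_path_of HJ.
pose M m x := running_max (path_of J x) m.
pose M' m x := running_max (shift_of J 1 x) m.
pose f m x := Num.max (- M' m x) (walk 1 x).
have fE m x : M m.+1 x = M' m x + f m x.
  by rewrite /M running_max_shift /f addr_maxr subrr addrC.
have iM m : Pr.-integrable setT (fun x => (M m x)%:E) := integrable_running_max m.
have mM' m : measurable_fun setT (M' m).
  by have := measurableT_comp (@measurable_running_max m) msh.
have mw1 := @measurable_walk 1 ler01.
have iw1 := integrable_walk ler01.
have mf m : measurable_fun setT (f m).
  by apply: measurable_maxr => //; exact: measurable_funN.
(* When [f m x] is [- M' m x], it lies between [walk 1 x] and 0. *)
have flt m x : `|f m x| <= `|walk 1 x|.
  rewrite /f /Num.max; case: ifPn => //; rewrite -leNgt => h.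
  have := running_max_ge0 (shift_of J 1 x) m; rewrite -/(M' m x) => M0.
  by rewrite normrN ger0_norm// ler0_norm; lra.
have if_ m : Pr.-integrable setT (fun x => (f m x)%:E).
  apply: le_integrable iw1 => //; first exact/measurable_EFinP.
  by move=> x _; rewrite !abse_EFin lee_fin.
have iM' m : Pr.-integrable setT (fun x => (M' m x)%:E).
  rewrite (_ : (fun x => _) = (fun x => (M m.+1 x)%:E - (f m x)%:E)%E); last first.
    by apply/funext => x; rewrite fE -EFinB addrK.
  exact: integrableB.
have toA g : Pr.-integrable setT g -> Pr.-integrable A g by exact: integrableS.
have MM' m : (\int[Pr]_(x in A) (M m x)%:E = \int[Pr]_(x in A) (M' m x)%:E)%E.
  rewrite [in RHS]AE /A.
  apply: (@ge0_integral_law _ _ _ Pr _ _ (path_of J) (shift_of J 1) _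
     (fun q => (running_max q m)%:E)) => //.
  - exact: measurable_unbounded_walk.
  - by apply/measurable_EFinP; exact: measurable_running_max.
  - by move=> q; rewrite lee_fin running_max_ge0.
  - by move=> B mB; apply/esym; exact: (levy_shift HJ ler01 mB).
have f_ge0 m : (0 <= \int[Pr]_(x in A) (f m x)%:E)%E.
  have e1 : (\int[Pr]_(x in A) (M m.+1 x)%:E =
      \int[Pr]_(x in A) (M m x)%:E + \int[Pr]_(x in A) (f m x)%:E)%E.
    rewrite (MM' m) -integralD//; [|exact: toA|exact: toA].
    by apply: eq_integral => x _; rewrite -EFinD -fE.
  have e2 : (\int[Pr]_(x in A) (M m x)%:E <= \int[Pr]_(x in A) (M m.+1 x)%:E)%E.
    apply: le_integral; [exact: mA|exact: toA|exact: toA|].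
    by move=> x _; rewrite lee_fin /M /= le_max lexx.
  move: e2; rewrite e1.
  have fin1 := integrable_fin_num mA (toA _ (iM m)).
  by rewrite -[X in (X <= _)%E -> _]adde0 leeD2lE.
have lim_ : (\int[Pr]_(x in A) (f m x)%:E @[m --> \oo] --> \int[Pr]_(x in A) (walk 1 x)%:E)%E.
  have [] := @dominated_convergence _ _ _ Pr A mA (fun m x => (f m x)%:E)
    (fun x => (walk 1 x)%:E) (fun x => `|(walk 1 x)%:E|%E) => //.
  - by move=> m; apply/measurable_EFinP; exact: measurable_funS (mf m).
  - by apply/measurable_EFinP; exact: measurable_funS mw1.
  - apply: aeW => x Ax; apply: cvg_near_cst.
    have [N hN] := nat_above (- walk 1 x).
    have : (shift_of J 1 @^-1` unbounded_walk) x by rewrite -AE.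
    move=> /(_ N Logic.I) [j _ /= hj].
    exists j => // m /= jm; congr (_ %:E); rewrite /f.
    apply/max_idPr.
    have [j0|j0] := posnP j.
      move: hj; rewrite j0 walk_shift// addr0 subrr ltNge.
      by rewrite ler0n.
    have := @running_max_ub (shift_of J 1 x) m j; rewrite j0 jm => /(_ erefl).
    by rewrite -/(M' m x); lra.
  - exact/toA/integrable_abse.
  - by apply: aeW => x m Ax; rewrite abse_EFin lee_fin.
have w_ge0 : (0 <= \int[Pr]_(x in A) (walk 1 x)%:E)%E.
  rewrite -(cvg_lim _ lim_)//; apply: lime_ge; first by apply/cvg_ex; eexists; exact: lim_.
  by apply: nearW.
rewrite (@indep_integral _ _ _ Pr A (walk 1)) in w_ge0 => //.
  apply/eqP; rewrite eq_le measure_ge0 andbT leNgt; apply/negP => p0.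
  by move: w_ge0; rewrite leNgt pmule_rlt0// drift.
(* [walk 1] reads the path stopped at 1 and [A], by shift invariance, the path after 1; past and
   future are independent. *)
move=> B mB.
have wE : walk 1 @^-1` B = stop_of J 1 @^-1` [set q | B (free q 1 k ord0)].
  by apply/seteqP; split => x /=; rewrite walk_stop// ler01 lexx.
have mB' : measurable [set q : fspace R E | B (free q 1 k ord0)].
  have mf1 : measurable_fun setT (fun q : fspace R E => free q 1 k ord0).
    by apply: (@measurable_free _ _ _ _ _ _ id); exact: measurable_id.
  exact: (measurable_preimage mf1 mB).
rewrite wE AE levy_stop_shift//; last exact: measurable_unbounded_walk.
by rewrite muleC.
Qed.

End negative_drift.

(** * From integer times to all times *)

Section supremum_finite.
Context (R : realType) (n : nat) d (T : measurableType d) (Pr : probability T R).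
Local Notation E := 'cV[R]_n.
Variables (J : R -> T -> E) (r : E) (P : 'M[R]_n) (k : 'I_n).
Hypothesis HJ : levy_process Pr J.
Hypothesis HP : forall x, input_path (J ^~ x).
Hypothesis intJ : forall t j, 0 <= t -> Pr.-integrable setT (fun x => (J t x j ord0)%:E).
Local Notation free := (free r P).
Local Notation walk := (walk J r P k).
Hypothesis drift : (\int[Pr]_x (walk 1 x)%:E < 0)%E.

Lemma measurable_walk_gt t b : 0 <= t -> measurable [set x | b < walk t x].
Proof.
move=> t0.
have := measurable_preimage (measurable_walk r P k HJ t0) (measurable_itv `]b, +oo[).
by congr measurable; apply/seteqP; split => x /=; rewrite in_itv/= andbT.
Qed.

Lemma rcont_walk x : rcont (walk ^~ x).
Proof. exact: (rcont_free r P (HP x)). Qed.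

(** On [0, 1] a cadlag path is bounded below, so the events [D N] decrease to the empty set and one
    [N] serves all times at once. The value 1/2 becomes the factor 2 in Ottaviani's inequality. *)
Lemma walk_lower_tail : exists c : R, forall s, 0 <= s <= 1 ->
  (Pr [set x | (walk s x < - c)%R] <= (2^-1)%:E)%E.
Proof.
pose D (N : nat) := \bigcup_m [set x | walk (tclip 1 (dyad R m)) x < - N%:R].
have clip0 m : 0 <= tclip 1 (dyad R m) :> R by case/andP: (tclip_itv (dyad R m) (@ler01 R)).
have mD N : measurable (D N).
  by apply: bigcupT_measurable => m; exact: (measurable_walkN r P k HJ).
have niD : nonincreasing_seq D.
  move=> i j ij; apply/subsetPset => x [m _ /= h]; exists m => //=.
  by apply: lt_le_trans h _; rewrite lerN2 ler_nat.
have [N hN] : exists N, (Pr (D N) < (2^-1)%:E)%E.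
  apply: contrapT => /forallNP h.
  have : ((2^-1)%:E <= Pr (\bigcap_N D N))%E.
    apply: measure_bigcap_ge => //.
      by rewrite (le_lt_trans (probability_le1 _ _)) ?ltry.
    by move=> i; rewrite leNgt; apply/negP/h.
  rewrite (_ : \bigcap_N D N = set0) ?measure0 ?lee_fin ?invr_le0 ?lerNgt; last first.
    apply/seteqP; split => // x hx.
    have := @rcll_bounded _ (fun t => -1 * walk t x) 1
      (rcontZ _ (@rcont_walk x)) (llimZ _ (llim_free r P (HP x) k)) ler01.
    move=> [M hM]; have [N hN] := nat_above M.
    have [m _ /=] := hx N Logic.I.
    have := hM _ (tclip_itv (dyad R m) ler01); rewrite mulN1r.
    by move=> ? ?; lra.
  by rewrite leNgt ltr0n.
exists N%:R => s s01; apply: le_trans (ltW hN).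
apply: le_measure; rewrite ?inE//.
  by apply: (measurable_walkN r P k HJ); case/andP: s01.
move=> x /= hs; apply: contrapT => h.
suff : -1 * walk s x <= N%:R by rewrite mulN1r; lra.
apply: (@rcont_le_dense _ (fun t => -1 * walk t x) 1 _
  [set v | exists m, v = tclip 1 (dyad R m)]) => //.
- exact: rcontZ (@rcont_walk x).
- move=> _ [m ->]; rewrite mulN1r lerNl leNgt; apply/negP => h1.
  by apply: h; exists m.
- exact: tclip_dyad_end.
- by move=> u e; exact: tclip_dyad_dense.
Qed.

Definition int_exceed (b : R) : set T := \bigcup_(m : nat) [set x | b < walk m%:R x].
Definition dyad_exceed (b : R) : set T := \bigcup_m [set x | b < walk (dyad R m) x].

Lemma measurable_int_exceed b : measurable (int_exceed b).
Proof. by apply: bigcupT_measurable => m; exact: measurable_walk_gt. Qed.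

Lemma measurable_dyad_exceed b : measurable (dyad_exceed b).
Proof.
by apply: bigcupT_measurable => m; apply: measurable_walk_gt; exact: dyad_ge0.
Qed.

(* Ottaviani's inequality: after the first passage above [b] on a grid, the walk
   is still above [b - c] at the next integer with probability at least 1/2. *)
Lemma grid_exceed (c b : R) (K : nat) :
  (forall s, 0 <= s <= 1 -> (Pr [set x | (walk s x < - c)%R] <= (2^-1)%:E)%E) ->
  (Pr (\bigcup_(i : nat) [set x | (b < walk (i%:R / 2 ^+ K) x)%R]) <=
    2%:E * Pr (int_exceed (b - c)))%E.
Proof.
move=> hc; pose g (i : nat) : R := i%:R / 2 ^+ K.
have g0 i : 0 <= g i by rewrite /g divr_ge0.
have gle i l : (l <= i)%N -> g l <= g i.
  by move=> li; rewrite /g ler_pM2r ?invr_gt0 ?exprn_gt0// ler_nat.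
(* The first integer strictly after the grid point; the time left until then is at most 1, the range
   in which [c] is valid. *)
pose cl i : R := (Num.truncn (g i)).+1%:R.
have clg i : 0 <= cl i - g i <= 1.
  have h1 : g i < cl i by exact: truncnS_gt.
  have h2 : (Num.truncn (g i))%:R <= g i by rewrite truncn_le.
  apply/andP; split; first by lra.
  by rewrite /cl -natr1; lra.
(* First passage above [b] at grid index [i], read off the stopped path; [CG] below is a condition
   on the path after [g i], so that independence applies. *)
pose CF i : set (fspace R E) := [set q | b < free q (g i) k ord0] `&`
  \bigcap_(l < i) [set q | free q (g l) k ord0 <= b].
pose CG i : set (fspace R E) := [set q | - c <= free q (cl i - g i) k ord0].
have mfree t : measurable_fun setT (fun q : fspace R E => free q t k ord0).
  by apply: (@measurable_free _ _ _ _ _ _ id); exact: measurable_id.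
have mCF i : measurable (CF i).
  apply: measurableI.
    have := measurable_preimage (mfree (g i)) (measurable_itv `]b, +oo[).
    by congr measurable; apply/seteqP; split => x /=; rewrite in_itv/= andbT.
  apply: bigcap_measurableType => l _.
  have := measurable_preimage (mfree (g l)) (measurable_itv `]-oo, b]).
  by congr measurable; apply/seteqP; split => x /=; rewrite in_itv/=.
have mCG i : measurable (CG i).
  have := measurable_preimage (mfree (cl i - g i)) (measurable_itv `[- c, +oo[).
  by congr measurable; apply/seteqP; split => x /=; rewrite in_itv/= andbT.
pose F i := stop_of J (g i) @^-1` CF i; pose G i := shift_of J (g i) @^-1` CG i.
have FE i x : F i x <-> b < walk (g i) x /\ forall l, (l < i)%N -> walk (g l) x <= b.
  rewrite /F /CF /= (@walk_stop _ _ _ _ _ _ _ _ (g i)) ?g0 ?lexx//.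
  split=> -[h1 h2]; split => // l li; have := h2 l li; rewrite /=.
    by rewrite walk_stop// g0 gle// ltnW.
  by rewrite walk_stop// g0 gle// ltnW.
have mF i : measurable (F i).
  exact: measurable_preimage (measurable_stop_of HJ (g0 i)) (mCF i).
have mG i : measurable (G i).
  exact: measurable_preimage (measurable_shift_of HJ (g0 i)) (mCG i).
have PG i : ((2^-1)%:E <= Pr (G i))%E.
  have /andP[cg0 _] := clg i.
  rewrite /G levy_shift//.
  rewrite (_ : path_of J @^-1` CG i = ~` [set x | walk (cl i - g i) x < - c]).
    rewrite probability_setC; last exact: (measurable_walkN r P k HJ).
    rewrite leeBrDr ?fin_num_measure//; last exact: (measurable_walkN r P k HJ).
    apply: le_trans (leeD2l _ (hc _ (clg i))) _.
    by rewrite -EFinD lee_fin; lra.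
  apply/seteqP; split => x; rewrite /CG /= walk_path//.
    by rewrite leNgt => /negP.
  by move=> h; rewrite leNgt; apply/negP.
have PFG i : (Pr (F i) <= 2%:E * Pr (F i `&` G i))%E.
  rewrite /F /G levy_stop_shift// -/(F i) -/(G i).
  rewrite muleCA -[leLHS]mule1; apply: lee_wpmul2l => //.
  rewrite -(@fineK _ (Pr (G i))) ?fin_num_measure// -EFinM lee_fin.
  have := PG i; rewrite -{1}(@fineK _ (Pr (G i))) ?fin_num_measure// lee_fin; lra.
have tF : trivIset setT F.
  apply/trivIsetP => i j _ _ ij; apply/seteqP; split => // x [/FE[hi hi'] /FE[hj hj']].
  have [h|h|h] := ltngtP i j.
  - by have := hj' i h; rewrite leNgt hi.
  - by have := hi' j h; rewrite leNgt hj.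
  - by rewrite h eqxx in ij.
have tFG : trivIset setT (fun i => F i `&` G i) by apply: trivIset_setIr.
have UE : \bigcup_(i : nat) [set x | b < walk (i%:R / 2 ^+ K) x] = \bigcup_i F i.
  apply/seteqP; split => x [i _]; last by move=> /FE[h _]; exists i.
  move=> h; have ex : exists i, b < walk (g i) x by exists i.
  exists (ex_minn ex) => //; apply/FE; case: ex_minnP => m hm hmin; split => // l lm.
  by rewrite leNgt; apply/negP => /hmin; rewrite leqNgt lm.
rewrite UE measure_bigcup//=.
apply: (@le_trans _ _ (\sum_(i <oo) (2%:E * Pr (F i `&` G i)))%E).
  rewrite [leLHS](_ : _ = \sum_(i <oo) Pr (F i))%E; first exact: lee_nneseries.
  by apply: eq_eseriesl => i; rewrite ?inE ?in_setT.
rewrite nneseriesZl//; apply: lee_wpmul2l => //.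
have -> : (\sum_(i <oo) Pr (F i `&` G i))%E = Pr (\bigcup_i (F i `&` G i)).
  rewrite measure_bigcup//=; last by move=> i _; exact: measurableI.
  by apply: eq_eseriesl => i; rewrite ?inE ?in_setT.
apply: le_measure; rewrite ?inE.
- by apply: bigcupT_measurable => i; exact: measurableI.
- exact: measurable_int_exceed.
move=> x [i _ [/FE[hF _] hG]]; exists (Num.truncn (g i)).+1 => //=.
move: hG; rewrite /G /CG /=.
have /andP[cg0 _] := clg i.
have cgE : g i + (cl i - g i) = cl i by rewrite addrC subrK.
by rewrite walk_shift// cgE -/(cl i); lra.
Qed.

(** Dyadic grids are nested and the bound of [grid_exceed] does not depend on the mesh, so it passes
    to the union. *)
Lemma dyad_exceed_le (c b : R) :
  (forall s, 0 <= s <= 1 -> (Pr [set x | (walk s x < - c)%R] <= (2^-1)%:E)%E) ->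
  (Pr (dyad_exceed b) <= 2%:E * Pr (int_exceed (b - c)))%E.
Proof.
move=> hc.
pose U K := \bigcup_(i : nat) [set x | b < walk (i%:R / 2 ^+ K) x].
have mU K : measurable (U K).
  by apply: bigcupT_measurable => i; apply: measurable_walk_gt; rewrite divr_ge0.
have ndU : nondecreasing_seq U.
  apply/nondecreasing_seqP => K; apply/subsetPset => x [i _ /= h].
  exists (2 * i)%N => //=; congr (_ < walk _ x): h.
  by rewrite natrM exprS invfM mulrACA mulfV ?mul1r// pnatr_eq0.
have mUU : measurable (\bigcup_K U K) by exact: bigcupT_measurable.
apply: (@le_trans _ _ (Pr (\bigcup_K U K))).
  apply: le_measure; rewrite ?inE//; first exact: measurable_dyad_exceed.
  move=> x [m _ /=]; rewrite /dyad; case: (odflt _ _) => i K h.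
  by exists K => //; exists i.
have cv := @nondecreasing_cvg_mu _ _ _ Pr U mU mUU ndU.
rewrite -(cvg_lim _ cv)//; apply: lime_le; first by apply/cvg_ex; eexists; exact: cv.
by apply: nearW => K; exact: grid_exceed.
Qed.

(** For every [N], unboundedness at dyadic times is at most twice as likely as exceeding [N - c] at
    an integer time. As [N] grows, the latter event shrinks into unboundedness at integer times,
    which is null by [walk_bounded]. *)
Lemma walk_has_sup : {ae Pr, forall x, exists M, forall m, walk (dyad R m) x <= M}.
Proof.
have [c hc] := walk_lower_tail.
exists (\bigcap_(N : nat) dyad_exceed N%:R); split.
- by apply: bigcapT_measurable => N; exact: measurable_dyad_exceed.
- apply/eqP; rewrite eq_le measure_ge0 andbT.
  set V := \bigcap_ _ _.
  have mV : measurable V by apply: bigcapT_measurable => N; exact: measurable_dyad_exceed.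
  have hV N : (2^-1%:E * Pr V <= Pr (int_exceed (N%:R - c)))%E.
    have : (Pr V <= 2%:E * Pr (int_exceed (N%:R - c)))%E.
      apply: le_trans (dyad_exceed_le N%:R hc); apply: le_measure; rewrite ?inE//.
        exact: measurable_dyad_exceed.
      by move=> x; apply.
    have mI := measurable_int_exceed (N%:R - c).
    rewrite -(@fineK _ (Pr V)) ?fin_num_measure//.
    rewrite -(@fineK _ (Pr (int_exceed _))) ?fin_num_measure// -!EFinM !lee_fin; lra.
  have : (2^-1%:E * Pr V <= Pr (\bigcap_(N : nat) int_exceed (N%:R - c)))%E.
    apply: measure_bigcap_ge => //.
    - by rewrite (le_lt_trans (probability_le1 _ _)) ?ltry//; exact: measurable_int_exceed.
    - by move=> N; exact: measurable_int_exceed.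
    - move=> i j ij; apply/subsetPset => x [m _ /= h]; exists m => //=.
      by apply: le_lt_trans h; rewrite lerD2r ler_nat.
  have mB := measurable_preimage (measurable_path_of HJ) (@measurable_unbounded_walk _ _ r P k).
  have sub : \bigcap_(N : nat) int_exceed (N%:R - c) `<=` path_of J @^-1` unbounded_walk r P k.
    move=> x h N _; have [N' hN'] := nat_above (N%:R + c).
    have [m _ /= hm] := h N' Logic.I; exists m => //=.
    by rewrite walk_path//; lra.
  have : (Pr (\bigcap_(N : nat) int_exceed (N%:R - c)) <= 0)%E.
    rewrite -(walk_bounded HJ intJ drift); apply: le_measure; rewrite ?inE//.
    by apply: bigcapT_measurable => N; exact: measurable_int_exceed.
  move=> h1 h2; have := le_trans h2 h1.
  rewrite -(@fineK _ (Pr V)) ?fin_num_measure// -!EFinM !lee_fin; lra.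
- move=> x /= h N _; apply: contrapT => h'; apply: h; exists N%:R => m.
  by rewrite leNgt; apply/negP => hm; apply: h'; exists m.
Qed.

Lemma walk_int_bounded :
  {ae Pr, forall x, exists M, forall m : nat, walk m%:R x <= M}.
Proof.
exists (path_of J @^-1` unbounded_walk r P k); split.
- exact: measurable_preimage (measurable_path_of HJ) (@measurable_unbounded_walk _ _ r P k).
- exact: walk_bounded.
- move=> x /= h N _; apply: contrapT => h'; apply: h; exists N%:R => m.
  by rewrite leNgt; apply/negP => hm; apply: h'; exists m => //=; rewrite walk_path.
Qed.

End supremum_finite.

(** * Stationarity and uniqueness *)

Lemma ae_event_eq d (T : measurableType d) (R : realType) (mu : {measure set T -> \bar R})
    (A B : set T) : measurable A -> measurable B ->
  {ae mu, forall x, A x <-> B x} -> mu A = mu B.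
Proof.
move=> mA mB [N [mN N0 hN]].
have le A' B' : measurable A' -> measurable B' ->
    (forall x, ~ N x -> A' x -> B' x) -> (mu A' <= mu B')%E.
  move=> mA' mB' h; apply: (@le_trans _ _ (mu (B' `|` N))).
    apply: le_measure; rewrite ?inE//; first exact: measurableU.
    by move=> x A'x; have [Nx|Nx] := pselect (N x); [right|left; exact: h].
  by rewrite -[leRHS]adde0 -N0; exact: measureU2.
have hAB x : ~ N x -> (A x <-> B x).
  by move=> Nx; apply: contrapT => h; apply: Nx; exact: hN.
by apply/eqP; rewrite eq_le; apply/andP; split; apply: le => // x /hAB [].
Qed.

Section stationarity.
Context (R : realType) (n : nat) d (T : measurableType d) (Pr : probability T R).
Local Notation E := 'cV[R]_n.
Variables (J : R -> T -> E) (r : E) (P : 'M[R]_n).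
Hypothesis Htree : tree_network r P.
Hypothesis T1 : forall i j, 0 < P i j -> r j ord0 / r i ord0 < P i j.
Hypothesis HJ : levy_process Pr J.
Hypothesis HP : forall x, input_path (J ^~ x).
Local Notation IP := (1%:M - P^T).
Local Notation Q := (invmx IP).
Local Notation Xbar := (Xbar r P).
Local Notation Ufun := (Ufun r P).
Local Notation content := (content r P).
Variable w : T -> E.
Hypotheses (mw : measurable_fun setT w) (w0 : forall x j, 0 <= w x j ord0).
Hypothesis wJ : indep_path Pr J w.
Let y x := Q *m w x.

Let my : measurable_fun setT y.
Proof. exact: measurable_mulmxl. Qed.

Let yJ : indep_path Pr J y.
Proof.
move=> B C mB mC.
have mQ : measurable_fun setT (fun v : E => Q *m v).
  by apply: measurable_mulmxl; exact: measurable_id.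
exact: (wJ (measurable_preimage mQ mB) mC).
Qed.

Lemma content_rev s x : 0 <= s ->
  content (J ^~ x) (y x) s = Ufun s (y x) (rev_of J s x).
Proof. by move=> s0; exact: (content_Ufun r P (HP x) (y x) s0). Qed.

Let mUpair s d' (T' : measurableType d') (f : T' -> E) (g : T' -> fspace R E) :
  measurable_fun setT f -> measurable_fun setT g ->
  measurable_fun setT (fun x => Ufun s (f x) (g x)).
Proof.
move=> mf mg.
exact: (measurableT_comp (@measurable_Ufun R n r P s) (measurable_fun_pair mf mg)).
Qed.

Lemma measurable_content s : 0 <= s ->
  measurable_fun setT (fun x => content (J ^~ x) (y x) s).
Proof.
move=> s0; rewrite (_ : (fun x => _) = (fun x => Ufun s (y x) (rev_of J s x))).
  by apply: mUpair => //; exact: (measurable_rev_of HJ s0).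
by apply/funext => x; rewrite content_rev.
Qed.

Hypothesis Hsup : {ae Pr, forall x j, has_sup (free_set r P (J ^~ x) j)}.
Hypothesis wlaw : forall A, measurable A ->
  Pr (w @^-1` A) = Pr ((fun x => IP *m Xbar (path_of J x)) @^-1` A).

Let ylaw A : measurable A -> Pr (y @^-1` A) = Pr ((fun x => Xbar (path_of J x)) @^-1` A).
Proof.
move=> mA.
have mQ : measurable_fun setT (fun v : E => Q *m v).
  by apply: measurable_mulmxl; exact: measurable_id.
rewrite [LHS](wlaw (measurable_preimage mQ mA)); congr (Pr _).
by apply/seteqP; split => x /=; rewrite (mulIP Htree).
Qed.

Let mXpath : measurable_fun setT (fun x => Xbar (path_of J x)).
Proof. exact: (measurableT_comp (@measurable_Xbar R n r P) (measurable_path_of HJ)). Qed.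

Lemma content_law s A : 0 <= s -> measurable A ->
  Pr ((fun x => content (J ^~ x) (y x) s) @^-1` A) = Pr (y @^-1` A).
Proof.
move=> s0 mA.
have mst := measurable_stop_of HJ s0; have msh := measurable_shift_of HJ s0.
have mXsh : measurable_fun setT (fun x => Xbar (shift_of J s x)).
  exact: (measurableT_comp (@measurable_Xbar R n r P) msh).
pose C := (fun yq : E * fspace R E => Ufun s yq.1 yq.2) @^-1` A.
have mC : measurable C by exact: measurable_preimage (@measurable_Ufun R n r P s) mA.
transitivity (Pr ((fun x => (y x, rev_of J s x)) @^-1` C)).
  by congr (Pr _); apply/seteqP; split => x /=; rewrite /C /= content_rev.
rewrite (pair_rev HJ my yJ s0 mC).
(* In both pairs the components are independent, and stationarity of increments gives the supremum
   of the shifted path the law of [y]. *)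
transitivity (Pr ((fun x => (Xbar (shift_of J s x), stop_of J s x)) @^-1` C)).
  apply: eq_law_prodT => // A' B mA' mB.
  have stE : stop_of J s @^-1` B = path_of J @^-1` (path_stop s @^-1` B).
    by apply/seteqP; split => x /=; rewrite stop_ofE.
  have mB' := measurable_preimage (@measurable_path_stop R n s) mB.
  rewrite {1}stE yJ// -stE ylaw//.
  have mXA := measurable_preimage (@measurable_Xbar R n r P) mA'.
  rewrite setIC (levy_stop_shift HJ s0 mB mXA) muleC; congr (_ * _)%E.
  by rewrite (levy_shift HJ s0 mXA).
(* The identity [Ufun_Xbar] is applied off the null set where some supremum is infinite. *)
rewrite ylaw//; apply: ae_event_eq.
- exact: measurable_preimage (mUpair s mXsh mst) mA.
- exact: measurable_preimage mXpath mA.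
case: Hsup => N [mN N0 hN]; exists N; split => // x h; apply: hN => hs; apply: h.
rewrite /C /=; suff -> : Ufun s (Xbar (shift_of J s x)) (stop_of J s x) = Xbar (path_of J x) by [].
exact: (Ufun_Xbar (HP x) hs s0).
Qed.

Let Wfun t (yq : E * fspace R E) : E := IP *m Ufun t yq.1 (path_rev t yq.2).

Let mWfun t : measurable_fun setT (Wfun t).
Proof.
apply: measurable_mulmxl; apply: mUpair; first exact: measurable_fst.
exact: (measurableT_comp (@measurable_path_rev R n t) measurable_snd).
Qed.

(** The content at [s] depends on the initial state and on the path up to [s] only, hence is
    independent of what follows; by [content_law] both pairs then have the same product law. *)
Lemma pair_law_shift s (C : set (E * fspace R E)) : 0 <= s -> measurable C ->
  Pr ((fun x => (content (J ^~ x) (y x) s, shift_of J s x)) @^-1` C) =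
  Pr ((fun x => (y x, path_of J x)) @^-1` C).
Proof.
move=> s0 mC.
apply: eq_law_prodT => //.
- exact: measurable_content.
- exact: (measurable_shift_of HJ s0).
- exact: (measurable_path_of HJ).
move=> A B mA mB.
pose C1 := (fun yq : E * fspace R E => Ufun s yq.1 (path_rev s yq.2)) @^-1` A.
have mC1 : measurable C1.
  apply: measurable_preimage mA; apply: mUpair; first exact: measurable_fst.
  exact: (measurableT_comp (@measurable_path_rev R n s) measurable_snd).
have E1 : (fun x => content (J ^~ x) (y x) s) @^-1` A =
    (fun x => (y x, stop_of J s x)) @^-1` C1.
  apply/seteqP; split => x; rewrite /C1 /= content_rev//.
    rewrite (_ : rev_of J s x = path_rev s (stop_of J s x))//.
    apply/funext => t; rewrite /rev_of /path_rev /stop_of (@tclip_id _ s s) ?s0 ?lexx//.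
    have /andP[c0 cs] := tclip_itv t s0.
    by rewrite (@tclip_id _ s (s - _))// subr_ge0 cs gerBl.
  rewrite (_ : rev_of J s x = path_rev s (stop_of J s x))//.
  apply/funext => t; rewrite /rev_of /path_rev /stop_of (@tclip_id _ s s) ?s0 ?lexx//.
  have /andP[c0 cs] := tclip_itv t s0.
  by rewrite (@tclip_id _ s (s - _))// subr_ge0 cs gerBl.
rewrite E1 (pair_stop_shift HJ my yJ s0 mC1 mB) -E1 content_law// levy_shift//.
by rewrite yJ.
Qed.

(** The values W(t_i + s) are functionals of V(s) and the path shifted by [s], and the W(t_i) are
    the same functionals of V(0) and the path. One equality of pair laws thus covers every
    finite-dimensional distribution. *)
Lemma stationary_content (W L : R -> T -> E) :
  (forall x, buffer_content r P (J ^~ x) (w x) (W ^~ x) (L ^~ x)) ->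
  stationary_process Pr W.
Proof.
move=> hW.
have WE t x : 0 <= t -> W t x = IP *m content (J ^~ x) (y x) t.
  by move=> t0; apply: (skorokhod_unique Htree T1 (HP x) (w0 x) (hW x)).
split.
  move=> t t0; rewrite (_ : W t = fun x => IP *m content (J ^~ x) (y x) t).
    by apply: measurable_mulmxl; exact: measurable_content.
  by apply/funext => x; exact: WE.
move=> k t s t0 s0 A mA.
pose C := \bigcap_(i < k) (Wfun (t i) @^-1` A i).
have mC : measurable C.
  by apply: bigcap_measurableType => i _; exact: measurable_preimage (mWfun _) (mA i).
have revE u q x : 0 <= u -> (forall v, 0 <= v -> q v = J v x) ->
   content (J ^~ x) (y x) u = Ufun u (y x) (path_rev u q).
  move=> u0 hq; rewrite content_rev//; congr (Ufun _ _ _); apply/funext => v.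
  rewrite /path_rev /rev_of !hq// subr_ge0.
  by case/andP: (tclip_itv v u0).
transitivity (Pr ((fun x => (content (J ^~ x) (y x) s, shift_of J s x)) @^-1` C)).
  congr (Pr _); rewrite /C preimage_bigcap; apply: eq_bigcapr => i _.
  have h x : W (t i + s) x = Wfun (t i) (content (J ^~ x) (y x) s, shift_of J s x).
    rewrite (addrC (t i)) WE ?addr_ge0// content_flow// (content_Ufun _ _ (input_path_shift _ _))//.
  by apply/seteqP; split => x /=; rewrite h.
rewrite pair_law_shift//; congr (Pr _); rewrite /C preimage_bigcap; apply: eq_bigcapr => i _.
have h x : W (t i) x = Wfun (t i) (y x, path_of J x).
  rewrite WE// /Wfun /= -revE// => v v0.
  by rewrite /path_of tpos_id.
by apply/seteqP; split => x /=; rewrite h.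
Qed.

End stationarity.

(** * Transfer to an extension of the probability space *)

Section extension.
Context (R : realType) (n : nat) d d' (T : measurableType d) (T' : measurableType d').
Local Notation E := 'cV[R]_n.
Variables (Pr : probability T R) (Pr' : probability T' R) (proj : T' -> T).
Hypothesis mproj : measurable_fun setT proj.
Hypothesis projE : forall A, measurable A -> Pr' (proj @^-1` A) = Pr A.
Variable J : R -> T -> E.

Lemma levy_process_proj : levy_process Pr J -> levy_process Pr' (fun t => J t \o proj).
Proof.
move=> HJ.
have mincr s t A : 0 <= s -> 0 <= t -> measurable A ->
    measurable ((fun x => J t x - J s x) @^-1` A).
  by move=> s0 t0 mA; apply: measurable_preimage mA; exact: (measurable_incr HJ s0 t0).
split.
- by move=> t t0; apply: measurableT_comp => //; exact: (levy_measurable HJ).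
- by move=> x; exact: (levy_cadlag HJ).
- by move=> x /=; rewrite (levy_0 HJ).
- move=> s t s0 t0 A mA.
  have := levy_stationary_increments HJ s0 t0 mA.
  rewrite -projE; last by apply: mincr => //; rewrite addr_ge0.
  rewrite -projE//; exact: measurable_preimage (levy_measurable HJ t0) mA.
- move=> k t t0 tnd A mA.
  have tk i : (i <= k)%N -> 0 <= t i.
    by elim: i => // i ih ik; apply: le_trans (tnd i ik); apply: ih; exact: ltnW.
  have := levy_independent_increments HJ t0 tnd mA.
  rewrite -projE; last first.
    apply: fin_bigcap_measurable => [|i /= ik]; first exact: finite_II.
    by apply: mincr => //; apply: tk => //; exact: ltnW.
  rewrite preimage_bigcap => ->; apply: eq_bigr => i _.
  rewrite -projE//; apply: mincr => //; apply: tk => //.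
  exact: ltnW.
Qed.

Lemma ae_proj (S : T -> Prop) : {ae Pr, forall x, S x} -> {ae Pr', forall x, S (proj x)}.
Proof.
move=> [N [mN N0 hN]]; exists (proj @^-1` N); split.
- exact: measurable_preimage.
- by rewrite projE.
- by move=> x h; apply: hN.
Qed.

End extension.

Section product_probability.
Context d1 d2 (T1 : measurableType d1) (T2 : measurableType d2) (R : realType).
Variables (P1 : probability T1 R) (P2 : probability T2 R).

Lemma product_probabilityP : exists P12 : probability (T1 * T2)%type R,
  forall A B, measurable A -> measurable B -> P12 (A `*` B) = (P1 A * P2 B)%E.
Proof.
have p1 : (P1 \x P2)%E setT = 1%E.
  rewrite -setXTT (product_measure1E P1 P2)// -[RHS]mule1.
  by congr (_ * _)%E; exact: probability_setT.
pose P12 : probability (T1 * T2)%type R :=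
  HB.pack (P1 \x P2)%E (Measure_isProbability.Build _ _ _ (P1 \x P2)%E p1).
by exists P12 => A B mA mB; rewrite -product_measure1E.
Qed.

End product_probability.

Lemma mfunP d1 d2 (T1 : measurableType d1) (T2 : measurableType d2) (f : T1 -> T2) :
  measurable_fun setT f -> exists F : {mfun T1 >-> T2}, F = f :> (T1 -> T2).
Proof.
move=> mf; pose F : {mfun T1 >-> T2} := HB.pack f (isMeasurableFun.Build _ _ _ _ f mf).
by exists F.
Qed.

Lemma ae_forall_ord d (T : measurableType d) (R : realType)
    (mu : {measure set T -> \bar R}) n (S : 'I_n -> T -> Prop) :
  (forall j, {ae mu, forall x, S j x}) -> {ae mu, forall x j, S j x}.
Proof.
move=> h; have [N hN] := choice h.
exists (\bigcup_(j in [set: 'I_n]) N j); split.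
- by apply: fin_bigcup_measurable => [|j _]; [exact: finite_finset|have [] := hN j].
- have mN (m : nat) : measurable (if insub m is Some j then N j else set0).
    by case: insubP => [j _ _|//]; have [] := hN j.
  apply/eqP; rewrite -measure_le0.
  have : mu.-negligible (\bigcup_m (if insub m is Some j then N j else set0)).
    apply: negligible_bigcup => m; case: insubP => [j _ _|_]; last exact: negligible_set0.
    by have [mj mj0 _] := hN j; apply/negligibleP.
  move=> [B [mB mB0 sB]]; rewrite -mB0; apply: le_measure; rewrite ?inE//.
    by apply: fin_bigcup_measurable => [|j _]; [exact: finite_finset|have [] := hN j].
  by move=> x [j _ Nx]; apply: sB; exists j => //; rewrite valK.
- move=> x /= /existsNP[j Sj]; exists j => //.
  by have [_ _] := hN j; apply.
Qed.

Section corollary.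
Context (R : realType) (n : nat) (d : measure_display) (T : measurableType d)
  (Pr : probability T R) (J : R -> T -> 'cV[R]_n) (r : 'cV[R]_n) (P : 'M[R]_n).
Hypothesis Htree : tree_network r P.
Hypothesis T1 : forall i j, 0 < P i j -> r j ord0 / r i ord0 < P i j.
Hypothesis T2 : forall (j : 'I_n) (omega : T), (0 < j)%N ->
  forall s t : R, 0 <= s -> s <= t -> J s omega j ord0 <= J t omega j ord0.
Hypothesis T3 : levy_process Pr J.
Hypothesis T4_integrable : forall (t : R) (j : 'I_n), 0 <= t ->
  Pr.-integrable setT (fun omega => (J t omega j ord0)%:E).
Local Notation EJ := (\col_j fine 'E_Pr[fun omega => J 1 omega j ord0] : 'cV[R]_n).
Local Notation E := 'cV[R]_n.
Local Notation IP := (1%:M - P^T).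
Local Notation Q := (invmx IP).
Hypothesis T4_stable : forall i, (Q *m EJ) i ord0 < r i ord0.

Lemma input_path_levy x : input_path (J ^~ x).
Proof.
split; [exact: (levy_cadlag T3)|exact: (levy_0 T3)|].
by move=> j j0 s t s0 st; exact: T2.
Qed.

Lemma walk_drift (r0 : E) k : (Q *m EJ) k ord0 < r0 k ord0 ->
  (\int[Pr]_x (walk J r0 P k 1 x)%:E < 0)%E.
Proof.
move=> hr.
have iJ j := T4_integrable j ler01.
rewrite (_ : (\int[Pr]_x _)%E = ((Q *m EJ) k ord0 - r0 k ord0)%:E).
  by rewrite lte_fin subr_lt0.
transitivity (\int[Pr]_x (\sum_j (Q k j)%:E * (J 1 x j ord0)%:E - (r0 k ord0)%:E))%E.
  apply: eq_integral => x _; rewrite /walk freeQ mul1r EFinB mxE -sumEFin.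
  by congr (_ - _)%E; apply: eq_bigr => j _; rewrite EFinM.
rewrite integralB//; last exact: finite_measure_integrable_cst.
  rewrite integral_cst// [X in (_ * X)%E](@probability_setT _ _ _ Pr) mule1 EFinB; congr (_ - _)%E.
  rewrite integral_sum//; last by move=> j; exact: integrableZl.
  rewrite mxE -sumEFin; apply: eq_bigr => j _.
  rewrite integralZl// EFinM mxE unlock fineK//.
  exact: integrable_fin_num.
by apply: integrable_sum => // j _; exact: integrableZl.
Qed.

Lemma ae_has_sup : {ae Pr, forall x j, has_sup (free_set r P (J ^~ x) j)}.
Proof.
apply: ae_forall_ord => j.
have [N [mN N0 hN]] := walk_has_sup T3 input_path_levy T4_integrable (walk_drift (T4_stable j)).
exists N; split => // x h; apply: hN => h'; apply: h.
exact: (has_sup_freeP r P (input_path_levy x) j).2.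
Qed.

Lemma free_supE x : free_sup J r P x = Xbar r P (path_of J x).
Proof. by rewrite [RHS](Xbar_sup _ _ (input_path_levy x)). Qed.

(** With rates [r0] halfway between the mean input Q EJ and [r] the drift is still negative, so the
    walk is bounded by some [M] at integer times. Draining at [r] instead subtracts a further m (r -
    r0), which eventually exceeds b + M. *)
Lemma ae_to_Ny : {ae Pr, forall x j, forall b, exists N : nat,
  forall m, (N <= m)%N -> b + free r P (J ^~ x) m%:R j ord0 <= 0}.
Proof.
pose r0 : E := \col_j ((r j ord0 + (Q *m EJ) j ord0) / 2).
have r0E j : r0 j ord0 = (r j ord0 + (Q *m EJ) j ord0) / 2 by rewrite mxE.
apply: ae_forall_ord => j.
have hj := T4_stable j.
have dr : (Q *m EJ) j ord0 < r0 j ord0 by rewrite r0E; lra.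
have [N [mN N0 hN]] := walk_int_bounded T3 T4_integrable (walk_drift dr).
exists N; split => // x h; apply: hN => -[M hM]; apply: h => b.
have e0 : 0 < r j ord0 - r0 j ord0 by rewrite r0E; lra.
have [K hK] := nat_above ((b + M) / (r j ord0 - r0 j ord0)).
exists K => m Km; have := hM m; rewrite /walk !freeQ.
have : b + M <= m%:R * (r j ord0 - r0 j ord0).
  by rewrite -ler_pdivrMr// (le_trans hK)// ler_nat.
rewrite mulrBr; lra.
Qed.

Let measurable_ge0 : measurable [set v : E | forall i, 0 <= v i ord0].
Proof.
rewrite (_ : [set v : E | _] = \bigcap_(i in [set: 'I_n]) [set v : E | 0 <= v i ord0]).
  apply: fin_bigcap_measurable => [|i _]; first exact: finite_finset.
  have := measurable_preimage (@measurable_coord R n i) (measurable_itv `[0, +oo[).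
  by congr measurable; apply/seteqP; split => x /=; rewrite in_itv/= andbT.
by apply/seteqP; split => v h i; [move=> _; exact: h|exact: (h i Logic.I)].
Qed.

Lemma ae_ge0_probability1 d0 (S : measurableType d0) (P0 : probability S R) (f : S -> E) :
  measurable_fun setT f -> {ae P0, forall x j, 0 <= f x j ord0} ->
  P0 (f @^-1` [set v : E | forall i, 0 <= v i ord0]) = 1%E.
Proof.
move=> mf [N [mN N0 hN]]; rewrite -(@probability_setT _ _ _ P0).
apply: ae_event_eq => //; first exact: measurable_preimage mf measurable_ge0.
by exists N; split => // x h; apply: hN => h'; apply: h.
Qed.

Lemma stationary_free_sup (Z : {RV Pr >-> E}) :
  (forall x, Z x = IP *m free_sup J r P x) ->
  stationary_distribution Pr J r P (distribution Pr Z).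
Proof.
move=> ZE; split.
  rewrite /distribution /pushforward; apply: (ae_ge0_probability1 (measurable_funPT Z)).
  have [N [mN N0 hN]] := ae_has_sup; exists N; split => // x h; apply: hN => hs; apply: h => j.
  by rewrite ZE free_supE; exact: (Xbar_parent_ge0 Htree T1 (input_path_levy x) hs).
move=> d' T' Pr' proj w hproj hw w0 ind W L hW.
have mproj : measurable_fun setT proj by exact: (measurable_funPT proj).
have HJ' := levy_process_proj mproj hproj T3.
apply: (@stationary_content R n _ T' Pr' (fun t => J t \o proj) r P Htree T1 HJ'
  _ w _ w0 _ _ _ W L hW).
- by move=> x; exact: input_path_levy.
- exact: (measurable_funPT w).
- exact: independent_indep_path.
- exact: (ae_proj mproj hproj ae_has_sup).
- move=> A mA; transitivity (distribution Pr Z A); first exact: hw.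
  have mZ := measurable_preimage (measurable_funPT Z) mA.
  rewrite /distribution /pushforward -[LHS](hproj _ mZ); congr (Pr' _).
  by apply/seteqP; split => x /=; rewrite ZE free_supE.
Qed.

(* The extension of the probability space is the product with a space [S]
   carrying the initial content [g]. *)
Lemma stationary_marginal d0 (S : measurableType d0) (P0 : probability S R)
    (P' : probability (S * T)%type R) (g : S -> E) (mu : probability E R) :
  (forall A B, measurable A -> measurable B -> P' (A `*` B) = (P0 A * Pr B)%E) ->
  measurable_fun setT g -> (forall x j, 0 <= g x j ord0) ->
  (forall A, measurable A -> P0 (g @^-1` A) = mu A) ->
  stationary_distribution Pr J r P mu ->
  forall t A, 0 <= t -> measurable A ->
  P' ((fun x => IP *m content r P (J ^~ x.2) (Q *m g x.1) t) @^-1` A) = mu A.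
Proof.
move=> hP' mg g0 lawg [_ stat] t A t0 mA.
have mg1 : measurable_fun setT (fun x : S * T => g x.1).
  exact: measurableT_comp mg measurable_fst.
have [w wE] := mfunP mg1.
have [proj projE] := mfunP (@measurable_snd _ _ S T).
have lawproj B : measurable B -> distribution P' proj B = Pr B.
  move=> mB; rewrite /distribution /pushforward projE.
  rewrite (_ : _ @^-1` B = setT `*` B).
    by rewrite hP'// probability_setT mul1e.
  by apply/seteqP; split => x //= [].
have wpre B : w @^-1` B = (g @^-1` B) `*` setT.
  by rewrite wE; apply/seteqP; split => x //= [].
have laww B : measurable B -> distribution P' w B = mu B.
  move=> mB; rewrite /distribution /pushforward wpre hP'//; last exact: measurable_preimage.
  by rewrite lawg// probability_setT mule1.
have w0 x j : 0 <= w x j ord0 by rewrite wE.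
have ind : independent_of_process P' w (fun t => J t \o proj).
  move=> B F mB sF.
  (* Process events on the product are preimages under [proj], hence independent of the first
     factor. *)
  have [F' mF' ->] : exists2 F', measurable F' & F = proj @^-1` F'.
    suff [F' mF' <-] : preimage_set_system setT proj measurable F.
      by exists F' => //; rewrite setTI.
    move: sF; apply: smallest_sub.
      exact/sigma_algebra_preimage/sigma_algebra_measurable.
    move=> _ [u u0 [C mC <-]]; exists (J u @^-1` C); last by rewrite comp_preimage.
    exact: measurable_preimage (levy_measurable T3 u0) mC.
  rewrite -[P' (proj @^-1` F')]/(distribution P' proj F') lawproj//.
  rewrite wpre (_ : _ `&` _ = (g @^-1` B) `*` F').
    rewrite !hP'//; try exact: measurable_preimage.
    by rewrite probability_setT mule1.
  by rewrite projE; apply/seteqP; split => x /= [] => [[? _] ?|? ?].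
have hsk x := skorokhod_exists Htree T1 (input_path_levy (proj x)) (w0 x).
have [mW st] := stat _ _ P' proj w lawproj laww w0 ind
  (fun t x => IP *m content r P (J ^~ (proj x)) (Q *m w x) t)
  (fun t x => regul r P (J ^~ (proj x)) (Q *m w x) t) hsk.
(* A single time 0 shifted by [t]: the content at [t] has the law of the content at 0, which is
   [w]. *)
have := st 1%N (fun=> 0) t (fun=> lexx _) t0 (fun=> A) (fun=> mA).
rewrite !bigcap_mkord !big_ord1 add0r.
have -> : (fun x => IP *m content r P (J ^~ (proj x)) (Q *m w x) 0) = w.
  by apply/funext => x; exact: (skorokhod_W0 (hsk x)).
rewrite -[RHS]/(distribution P' w A) laww// => <-; congr (P' _).
by apply/seteqP; split => x /=; rewrite wE projE.
Qed.

(** Initial contents must be nonnegative at every outcome, whereas [mu] is only known to give the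
    orthant full measure; [pos_part] repairs the null set without changing the law. *)
Let pos_part (v : E) : E := \col_j Num.max (v j ord0) 0.

Let measurable_pos_part : measurable_fun setT pos_part.
Proof.
apply: measurable_fun_cV => j; under eq_fun do rewrite mxE.
by apply: measurable_maxr => //; exact: measurable_coord.
Qed.

Let pos_part_law (mu : probability E R) : mu [set x | forall i, 0 <= x i ord0] = 1%E ->
  forall A, measurable A -> mu (pos_part @^-1` A) = mu A.
Proof.
move=> mu1 A mA; apply: ae_event_eq => //.
  exact: measurable_preimage measurable_pos_part mA.
exists (~` [set x : E | forall i, 0 <= x i ord0]); split.
- exact: measurableC.
- apply: etrans (probability_setC mu measurable_ge0) _.
  by rewrite [X in (1 - X)%E]mu1 subee.
- move=> v /= h hv; apply: h; rewrite (_ : pos_part v = v)//.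
  by apply/colP => j; rewrite mxE; apply/max_idPl; exact: hv.
Qed.

(* Two contents driven by the same input from different initial states agree as
   soon as both shifted free processes are nonpositive, which happens eventually. *)
Lemma stationary_le (mu nu : probability E R) :
  stationary_distribution Pr J r P mu -> stationary_distribution Pr J r P nu ->
  forall A, measurable A -> (mu A <= nu A)%E.
Proof.
move=> smu snu A mA.
have [P0 hP0] := product_probabilityP mu nu.
have [P' hP'] := product_probabilityP P0 Pr.
pose g1 (s : E * E) := pos_part s.1; pose g2 (s : E * E) := pos_part s.2.
have mg1 : measurable_fun setT g1.
  exact: measurableT_comp measurable_pos_part measurable_fst.
have mg2 : measurable_fun setT g2.
  exact: measurableT_comp measurable_pos_part measurable_snd.
have pos0 v j : 0 <= pos_part v j ord0 by rewrite mxE le_max lexx orbT.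
have law1 B : measurable B -> P0 (g1 @^-1` B) = mu B.
  move=> mB; rewrite (_ : g1 @^-1` B = (pos_part @^-1` B) `*` setT).
    rewrite hP0//; last exact: measurable_preimage.
    by rewrite probability_setT mule1 pos_part_law//; case: smu.
  by apply/seteqP; split => x //= [].
have law2 B : measurable B -> P0 (g2 @^-1` B) = nu B.
  move=> mB; rewrite (_ : g2 @^-1` B = setT `*` (pos_part @^-1` B)).
    rewrite hP0//; last exact: measurable_preimage.
    by rewrite probability_setT mul1e pos_part_law//; case: snu.
  by apply/seteqP; split => x //= [].
pose y (g : E * E -> E) (x : (E * E) * T) := Q *m g x.1.
pose V g t (x : (E * E) * T) := IP *m content r P (J ^~ x.2) (y g x) t.
have V1 := stationary_marginal hP' mg1 (fun x j => pos0 _ j) law1 smu.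
have V2 := stationary_marginal hP' mg2 (fun x j => pos0 _ j) law2 snu.
pose low g j (m : nat) := [set x | y g x j ord0 + free r P (J ^~ x.2) m%:R j ord0 <= 0].
have mproj : measurable_fun setT (@snd (E * E) T) by exact: measurable_snd.
have lawproj B : measurable B -> P' (snd @^-1` B) = Pr B.
  move=> mB; rewrite (_ : _ @^-1` B = setT `*` B).
    by rewrite hP'// probability_setT mul1e.
  by apply/seteqP; split => x //= [].
have HJ' := levy_process_proj mproj lawproj T3.
have mlow g j m : measurable_fun setT g -> measurable (low g j m).
  move=> mg.
  have mf : measurable_fun setT (fun x => y g x j ord0 + free r P (J ^~ x.2) m%:R j ord0).
    apply: measurable_funD.
      apply: (measurableT_comp (measurable_coord j)); apply: measurable_mulmxl.
      exact: measurableT_comp mg measurable_fst.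
    exact: (measurable_walk r P j HJ').
  have := measurable_preimage mf (measurable_itv `]-oo, 0]).
  by congr measurable; apply/seteqP; split => x /=; rewrite in_itv.
(* At all integer times from [m] on, both initial states are used up in every coordinate of V. *)
pose good m := \bigcap_(j in [set: 'I_n]) (\bigcap_(l in [set l | (m <= l)%N])
  (low g1 j l `&` low g2 j l)).
have mgood m : measurable (good m).
  apply: fin_bigcap_measurable => [|j _]; first exact: finite_finset.
  by apply: bigcap_measurableType => l _; apply: measurableI; exact: mlow.
have bad0 : P' (\bigcap_m ~` good m) = 0%E.
  apply: measure_negligible.
    by apply: bigcapT_measurable => m; exact: measurableC.
  have [N [mN N0 hN]] := ae_proj mproj lawproj ae_to_Ny.
  exists N; split => // x hx; apply: hN => h.
  have hj j : exists K, forall l, (K <= l)%N -> (low g1 j l `&` low g2 j l) x.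
    have [K1 h1] := h j (y g1 x j ord0); have [K2 h2] := h j (y g2 x j ord0).
    exists (maxn K1 K2) => l; rewrite geq_max => /andP[l1 l2].
    by split; [exact: h1|exact: h2].
  have [K hK] := choice hj.
  apply: (hx (\max_j K j)%N Logic.I) => j _ l /= lK; apply: hK.
  by apply: leq_trans lK; exact: (leq_bigmax j).
(* Off an event of probability below [e] the two contents agree at time [m], where by stationarity
   their laws are still [mu] and [nu]. *)
apply/lee_addgt0Pr => e e0.
have [m hm] : exists m, (P' (~` good m) < e%:E)%E.
  apply: contrapT => /forallNP h.
  have : (e%:E <= P' (\bigcap_m ~` good m))%E.
    apply: measure_bigcap_ge.
    - by rewrite (le_lt_trans (probability_le1 _ _)) ?ltry//; exact: measurableC.
    - by move=> m; exact: measurableC.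
    - move=> i j ij; apply/subsetPset; apply: subsetC => x hx k _ l /= jl.
      by apply: (hx k Logic.I); exact: leq_trans jl.
    - by move=> i; rewrite leNgt; apply/negP; exact: h.
  by rewrite bad0 lee_fin leNgt e0.
have mV g : measurable_fun setT g -> measurable_fun setT (V g m%:R).
  move=> mg; apply: measurable_mulmxl.
  apply: (@measurable_content R n _ _ P' (fun t => J t \o snd) r P HJ' _ (fun x => g x.1)) => //.
  - by move=> x; exact: input_path_levy.
  - exact: measurableT_comp mg measurable_fst.
rewrite -(V1 m%:R A (ler0n _ _) mA) -(V2 m%:R A (ler0n _ _) mA).
apply: (@le_trans _ _ (P' (V g2 m%:R @^-1` A `|` ~` good m))).
  apply: le_measure; rewrite ?inE.
  - exact: measurable_preimage (mV _ mg1) mA.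
  - apply: measurableU; last exact: measurableC.
    exact: measurable_preimage (mV _ mg2) mA.
  move=> x /= Ax; have [gx|gx] := pselect (good m x); last by right.
  left; rewrite /V (@content_coupling R n r P _ _ (y g1 x))//.
  - exact: input_path_levy.
  - by move=> j; have [_] := gx j Logic.I m (leqnn m).
  - by move=> j; have [] := gx j Logic.I m (leqnn m).
have h1 := measurable_preimage (mV _ mg2) mA.
have h2 := measurableC (mgood m).
apply: (@le_trans _ _ (P' (V g2 m%:R @^-1` A) + P' (~` good m))%E).
  exact: measureU2.
by rewrite leeD2l// ltW.
Qed.

End corollary.

Theorem corollary5p1 (R : realType) (n : nat)
    (d : measure_display) (T : measurableType d) (Pr : probability T R)
    (J : R -> T -> 'cV[R]_n) (r : 'cV[R]_n) (P : 'M[R]_n)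
    (Htree : tree_network r P)
    (T1 : forall i j, 0 < P i j -> r j ord0 / r i ord0 < P i j)
    (T2 : forall (j : 'I_n) (omega : T), (0 < j)%N ->
      forall s t : R, 0 <= s -> s <= t -> J s omega j ord0 <= J t omega j ord0)
    (T3 : levy_process Pr J)
    (T4_integrable : forall (t : R) (j : 'I_n), 0 <= t ->
      Pr.-integrable setT (fun omega => (J t omega j ord0)%:E))
    (T4_stable : forall i,
      (invmx (1%:M - P^T) *m
        (\col_j fine 'E_Pr[fun omega => J 1 omega j ord0])) i ord0
      < r i ord0) :
  {ae Pr, forall omega, forall k, has_sup (free_values J r P omega k)} /\
  exists Z : {RV Pr >-> 'cV[R]_n},
    [/\ forall omega, Z omega = (1%:M - P^T) *m free_sup J r P omega,
        stationary_distribution Pr J r P (distribution Pr Z)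
      & forall mu : probability 'cV[R]_n R,
          stationary_distribution Pr J r P mu ->
          forall A, measurable A -> mu A = distribution Pr Z A].
Proof.
split; first exact: (ae_has_sup T2 T3 T4_integrable T4_stable).
have mZ : measurable_fun setT (fun x => (1%:M - P^T) *m free_sup J r P x).
  apply: measurable_mulmxl.
  rewrite (_ : free_sup J r P = fun x => Xbar r P (path_of J x)).
    exact: (measurableT_comp (@measurable_Xbar R n r P) (measurable_path_of T3)).
  by apply/funext => x; exact: (free_supE r P T2 T3).
have [Z ZE] := mfunP mZ.
have ZE' omega : Z omega = (1%:M - P^T) *m free_sup J r P omega by rewrite ZE.
have statZ := stationary_free_sup Htree T1 T2 T3 T4_integrable T4_stable ZE'.
exists Z; split => // mu smu A mA.
have le := stationary_le Htree T1 T2 T3 T4_integrable T4_stable.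
by apply/eqP; rewrite eq_le !le.
Qed.
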